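(* Let $k$ be a fixed positive integer (not depending on $n$). For the uniform random intersection graph $G_u(n,P_n,K_n)$, define $\alpha_n$ by $$\frac{K_n^2}{P_n}=\frac{\ln n+(k-1)\ln\ln n+\alpha_n}{n}.$$ If $K_n=\Omega\big((\ln n)^3\big)$ and $|\alpha_n|=o(\ln n)$, then $$\lim_{n\to\infty}\mathbb{P}[G_u(n,P_n,K_n)\text{ is }k\text{-robust}]=\begin{cases}0,&\text{if }\lim_{n\to\infty}\alpha_n=-\infty,\\ 1,&\text{if }\lim_{n\to\infty}\alpha_n=\infty.\end{cases}$$
   Context: Uniform random intersection graph $G_u(n,P_n,K_n)$: for integers $1\le K_n\le P_n$, $n$ nodes $v_1,\ldots,v_n$ each independently receive a uniformly random $K_n$-element subset $S_i$ of a pool of $P_n$ objects; distinct $v_i,v_j$ are adjacent iff $S_i\cap S_j\neq\emptyset$. A graph with node set $\mathcal{V}$ is $k$-robust if for every nonempty proper subset $T\subsetneq\mathcal{V}$, either some node in $T$ has at least $k$ neighbors in $\mathcal{V}\setminus T$, or some node in $\mathcal{V}\setminus T$ has at least $k$ neighbors in $T$. All limits and asymptotic notation are as $n\to\infty$. *)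

(* Defs.v *)
From mathcomp Require Import all_boot all_order all_algebra.

Set Implicit Arguments.
Unset Strict Implicit.
Unset Printing Implicit Defensive.

Import Order.TTheory GRing.Theory Num.Theory.
Local Open Scope ring_scope.

(* A simple graph is a symmetric irreflexive [e : rel V] on a finite type. *)
Definition nbrs_in (V : finType) (e : rel V) (v : V) (A : {set V}) : {set V} :=
  [set w in A | e v w].

Definition k_robust (V : finType) (e : rel V) (k : nat) : bool :=
  [forall T : {set V}, (T != set0) && (T \proper [set: V]) ==>
     ([exists v in T, (k <= #|nbrs_in e v (~: T)|)%N]
      || [exists v in ~: T, (k <= #|nbrs_in e v T|)%N])].

Definition unif_pmf (R : realFieldType) (T : finType) (A : {set T}) (x : T) : R :=
  if x \in A then #|A|%:R^-1 else 0.

Definition K_subsets (P K : nat) : {set {set 'I_P}} :=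
  [set A : {set 'I_P} | #|A| == K].

(* [S i] is the set of objects received by node [i]; independence of the nodes'
   choices is the product form of the joint mass function. *)
Definition assignment_pmf (R : realFieldType) (n P K : nat)
    (S : {ffun 'I_n -> {set 'I_P}}) : R :=
  \prod_(i < n) unif_pmf R (K_subsets P K) (S i).

Definition assignment_prob (R : realFieldType) (n P K : nat)
    (E : pred {ffun 'I_n -> {set 'I_P}}) : R :=
  \sum_(S | E S) assignment_pmf R K S.

Definition intersection_graph (n P : nat) (S : {ffun 'I_n -> {set 'I_P}}) :
    rel 'I_n :=
  [rel i j | (i != j) && (S i :&: S j != set0)].

Definition prob_k_robust (R : realFieldType) (n P K k : nat) : R :=
  assignment_prob R K
    (fun S : {ffun 'I_n -> {set 'I_P}} => k_robust (intersection_graph S) k).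

Lemma intersection_graph_sym n P (S : {ffun 'I_n -> {set 'I_P}}) :
  symmetric (intersection_graph S).
Proof. by move=> i j; rewrite /intersection_graph /= [j == i]eq_sym setIC. Qed.

Lemma intersection_graph_irr n P (S : {ffun 'I_n -> {set 'I_P}}) :
  irreflexive (intersection_graph S).
Proof. by move=> i; rewrite /intersection_graph /= eqxx. Qed.

Lemma assignment_probT (R : realFieldType) (n P K : nat) :
  (K <= P)%N -> assignment_prob R K (predT : pred {ffun 'I_n -> {set 'I_P}}) = 1.
Proof.
move=> leKP; rewrite /assignment_prob /assignment_pmf.
rewrite -(bigA_distr_bigA (fun _ A => unif_pmf R (K_subsets P K) A)) /=.
rewrite big1 // => i _; rewrite /unif_pmf -big_mkcond /= sumr_const.
rewrite -[X in X = _]mulr_natl mulfV // pnatr_eq0 -lt0n.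
by rewrite /K_subsets card_draws card_ord bin_gt0.
Qed.

(* Main.v *)
(** Write [s = K^2 / P] and [lam = n s].

    Zero law.  A node of degree smaller than [k] destroys [k]-robustness.  Split
    the nodes into two halves and count the nodes of the first half that have no
    neighbour there and fewer than [k] neighbours in the other half.  The object
    sets of two such nodes are disjoint, so the events that a third object set
    meets the one or the other are negatively correlated and the pair
    probability is at most the square of the single one, up to [1 / (1 - s)].
    The expected count is of order [n lam^(k-1) e^(-lam)], that is [e^(-alpha)],
    and Chebyshev's inequality applies.

    One law.  If the graph is not [k]-robust, some set [T] of [t <= n / 2] nodes
    has all its members sending fewer than [k] edges to the complement [W].
    Outside an event of probability [O(lam^2 / K)], which is where
    [K = Omega((ln n)^3)] enters, the pairwise intersections of the object sets
    have total size at most [P / (2 K)], so that unions of object sets are almost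
    as large as if they were disjoint.  Then the moment [E y^hits] at
    [y = 1 / lam] bounds the probability that a fresh object set meets fewer than
    [k] sets of [W] by [C lam^(k-1) e^(-(n - t) s)], independently for the members
    of [T], and the union bound over [T] is a geometric series of ratio
    [C e^(-alpha)]. *)

Require Import Defs.
From mathcomp Require Import all_boot all_order all_algebra.
From mathcomp Require Import ring lra zify.
Import Order.TTheory GRing.Theory Num.Theory.
Local Open Scope ring_scope.
Set Implicit Arguments.
Unset Strict Implicit.
Unset Printing Implicit Defensive.

Lemma bernoulli_ineq (R : realFieldType) (x : R) m :
  0 <= x <= 1 -> 1 - m%:R * x <= (1 - x) ^+ m.
Proof.
move=> /andP[x0 x1]; elim: m => [|m IH]; first by rewrite mul0r subr0.
apply: (@le_trans _ _ ((1 - m%:R * x) * (1 - x))).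
  have : 0 <= m%:R * (x * x) by rewrite !mulr_ge0 ?ler0n.
  by rewrite -natr1; nra.
by rewrite [leRHS]exprSr ler_wpM2r // subr_ge0.
Qed.

(** * Product measures on finite functions *)

Section ProductExpectation.
Variables (R : realFieldType) (I T : finType) (mu : T -> R).
Hypothesis mu_ge0 : forall x, 0 <= mu x.
Hypothesis mu_sum : \sum_x mu x = 1.

Definition expect (F : {ffun I -> T} -> R) : R :=
  \sum_(S : {ffun I -> T}) (\prod_i mu (S i)) * F S.

Definition upd (S : {ffun I -> T}) (v : I) (x : T) : {ffun I -> T} :=
  [ffun i => if i == v then x else S i].

Lemma updE S v x i : upd S v x i = if i == v then x else S i.
Proof. by rewrite ffunE. Qed.

Lemma upd_same S v x : upd S v x v = x.
Proof. by rewrite updE eqxx. Qed.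

Lemma upd_other S v x i : i != v -> upd S v x i = S i.
Proof. by rewrite updE => /negbTE->. Qed.

Implicit Types (F G : {ffun I -> T} -> R) (S : {ffun I -> T}).

(** Comparison is needed only on the support, since an assignment with a coordinate of mass zero has
    weight zero. This is how [#|S i| = K] becomes available inside expectations. *)
Lemma expect_le F G :
  (forall S : {ffun I -> T}, (forall i, mu (S i) != 0) -> F S <= G S) -> expect F <= expect G.
Proof.
move=> leFG; apply: ler_sum => S _.
have [/forallP S0|] := boolP [forall i, mu (S i) != 0].
  by apply: ler_wpM2l; [exact: prodr_ge0|exact: leFG].
by move=> /forallPn[i /negPn/eqP Si]; rewrite (bigD1 i)//= Si !mul0r.
Qed.

Lemma expect_eq F G :
  (forall S : {ffun I -> T}, (forall i, mu (S i) != 0) -> F S = G S) -> expect F = expect G.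
Proof.
by move=> eqFG; apply/eqP; rewrite eq_le; apply/andP; split;
  apply: expect_le => S /eqFG ->.
Qed.

Lemma expect_ge0 F : (forall S, 0 <= F S) -> 0 <= expect F.
Proof.
by move=> F0; apply: sumr_ge0 => S _; apply: mulr_ge0 => //; apply: prodr_ge0.
Qed.

Lemma expectD F G : expect (fun S => F S + G S) = expect F + expect G.
Proof. by rewrite -big_split; apply: eq_bigr => S _; rewrite mulrDr. Qed.

Lemma expectZ c F : expect (fun S => c * F S) = c * expect F.
Proof. by rewrite mulr_sumr; apply: eq_bigr => S _; rewrite mulrCA. Qed.

Lemma expect_sum (J : finType) (A : pred J) (F : J -> {ffun I -> T} -> R) :
  expect (fun S => \sum_(j | A j) F j S) = \sum_(j | A j) expect (F j).
Proof.
rewrite exchange_big /=; apply: eq_bigr => S _; exact: mulr_sumr.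
Qed.

Lemma expect1 : expect (fun=> 1) = 1.
Proof.
rewrite /expect; under eq_bigr do rewrite mulr1.
rewrite -(bigA_distr_bigA (fun _ => mu)) /=.
by rewrite big1.
Qed.

Lemma expect_cst c : expect (fun=> c) = c.
Proof.
rewrite -[RHS]mulr1 -[X in _ = _ * X]expect1 -expectZ.
by apply: eq_bigr => S _; rewrite mulr1.
Qed.

(** Independence in working form. Exchanging [S v] with the fresh value is an involution of pairs
    that preserves the joint weight. *)
Lemma expect_resample v F :
  expect F = expect (fun S => \sum_x mu x * F (upd S v x)).
Proof.
have wE (S : {ffun I -> T}) : \prod_i mu (S i) = mu (S v) * \prod_(i | i != v) mu (S i).
  by rewrite (bigD1 v).
pose swap (p : {ffun I -> T} * T) := (upd p.1 v p.2, p.1 v).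
have swapK : involutive swap.
  move=> [S x]; rewrite /swap /= upd_same; congr pair.
  by apply/ffunP => i; rewrite !updE; case: eqP => // ->.
transitivity (\sum_(p : {ffun I -> T} * T) (\prod_i mu (p.1 i)) * mu p.2 * F p.1).
  rewrite -(pair_bigA _ (fun (S : {ffun I -> T}) x => (\prod_i mu (S i)) * mu x * F S)) /=.
  by apply: eq_bigr => S _; rewrite -mulr_suml -mulr_sumr mu_sum mulr1.
rewrite (reindex_inj (inv_inj swapK)) /=.
rewrite [RHS](eq_bigr (fun S : {ffun I -> T} => \sum_x (\prod_i mu (S i)) * (mu x * F (upd S v x)))); last first.
  by move=> S _; rewrite mulr_sumr.
rewrite (pair_bigA _ (fun (S : {ffun I -> T}) x => (\prod_i mu (S i)) * (mu x * F (upd S v x)))) /=.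
apply: eq_bigr => -[S x] _ /=; rewrite !wE upd_same.
rewrite (eq_bigr (fun i => mu (S i))); last by move=> i iv; rewrite upd_other.
by ring.
Qed.

End ProductExpectation.

(** * Uniform K-subsets *)

Section Uniform.
Variables (R : realFieldType) (P K : nat).
Hypothesis leKP : (K <= P)%N.

Local Notation mu := (unif_pmf R (K_subsets P K)).

Lemma unif_pmf_ge0 x : 0 <= mu x.
Proof. by rewrite /unif_pmf; case: ifP => // _; rewrite invr_ge0 ler0n. Qed.

Lemma card_K_subsets : #|K_subsets P K| = 'C(P, K).
Proof. by rewrite /K_subsets card_draws card_ord. Qed.

Lemma bin_neq0 : 'C(P, K)%:R != 0 :> R.
Proof. by rewrite pnatr_eq0 -lt0n bin_gt0. Qed.

Lemma unif_pmf_sum : \sum_x mu x = 1.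
Proof.
rewrite /unif_pmf -big_mkcond /= sumr_const -[X in X = _]mulr_natl card_K_subsets.
by rewrite mulfV // bin_neq0.
Qed.

Lemma unif_pmf_card x : mu x != 0 -> #|x| = K.
Proof.
by rewrite /unif_pmf inE; case: ifP => [/eqP//|_]; rewrite eqxx.
Qed.

Definition avoid_prob (b : nat) : R := 'C(P - b, K)%:R / 'C(P, K)%:R.

Lemma unif_pmf_avoid (A : {set 'I_P}) :
  \sum_x mu x * (x :&: A == set0)%:R = avoid_prob #|A|.
Proof.
rewrite (bigID (fun x => (x :&: A == set0) && (#|x| == K))) /= [X in _ + X]big1 ?addr0; last first.
  move=> x /nandP[/negbTE-> |xK]; first by rewrite mulr0.
  by rewrite /unif_pmf inE (negbTE xK) mul0r.
rewrite (eq_bigr (fun=> 'C(P, K)%:R^-1)); last first.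
  by move=> x /andP[-> xK]; rewrite /unif_pmf inE xK mulr1 card_K_subsets.
rewrite sumr_const -[LHS]mulr_natl /avoid_prob; congr (_%:R * _).
have -> : (P - #|A|)%N = #|~: A| by have := cardsC A; rewrite card_ord; lia.
rewrite -(cards_draws (~: A) K); apply: eq_card => x.
by rewrite inE /= unfold_in -disjoints_subset setI_eq0.
Qed.

Lemma avoid_prob_ge0 b : 0 <= avoid_prob b.
Proof. by rewrite divr_ge0 ?ler0n. Qed.

Lemma avoid_prob0 : avoid_prob 0 = 1.
Proof. by rewrite /avoid_prob subn0 divff // bin_neq0. Qed.

Hypothesis K_gt0 : (0 < K)%N.

Definition avoid_ratio (m : nat) : R := (m - K)%:R / m%:R.

Lemma avoid_ratio_ge0 m : 0 <= avoid_ratio m.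
Proof. by rewrite divr_ge0 ?ler0n. Qed.

Lemma avoid_ratio_mono m m' : (m <= m')%N -> avoid_ratio m <= avoid_ratio m'.
Proof.
case: m => [|m] mm'; first by rewrite /avoid_ratio sub0n mul0r avoid_ratio_ge0.
rewrite /avoid_ratio ler_pdivrMr ?ltr0n // mulrAC ler_pdivlMr ?ltr0n; last by lia.
by rewrite -!natrM ler_nat; nia.
Qed.

Lemma avoid_probS b : avoid_prob b.+1 = avoid_prob b * avoid_ratio (P - b).
Proof.
rewrite /avoid_prob mulrAC; congr (_ / _); rewrite subnS /avoid_ratio.
case: (P - b)%N => [|m]; first by rewrite bin_small // mul0r.
have /(congr1 (fun x => x%:R : R)) := mul_bin_down m.+1 K.
rewrite !natrM /= => E; apply: (@mulfI _ m.+1%:R); first by rewrite pnatr_eq0.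
by rewrite E mulrCA mulrC; congr (_ * _); rewrite mulrCA divff ?mulr1 // pnatr_eq0.
Qed.

(** The ratios of consecutive values decrease as objects are removed, so the steps from [a] to
    [a + b] lose at least as much as those from 0 to [b]. This is the source of negative
    correlation. *)
Lemma avoid_probD a b : avoid_prob (a + b) <= avoid_prob a * avoid_prob b.
Proof.
elim: b => [|b IH]; first by rewrite addn0 avoid_prob0 mulr1.
rewrite addnS !avoid_probS mulrA; apply: ler_pM => //; [exact: avoid_prob_ge0|exact: avoid_ratio_ge0|].
by apply: avoid_ratio_mono; lia.
Qed.

Lemma pool_gt0 : 0 < P%:R :> R.
Proof. by rewrite ltr0n; lia. Qed.

Lemma avoid_prob1 : avoid_prob 1 = 1 - K%:R / P%:R.
Proof.
rewrite avoid_probS avoid_prob0 mul1r /avoid_ratio subn0 natrB // mulrBl divff //.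
by rewrite gt_eqF // pool_gt0.
Qed.

Lemma avoid_prob_le_expn b : avoid_prob b <= (1 - K%:R / P%:R) ^+ b.
Proof.
elim: b => [|b IH]; first by rewrite avoid_prob0.
rewrite -addn1 (le_trans (avoid_probD _ _)) //.
by rewrite avoid_prob1 addn1 exprSr ler_wpM2r // -avoid_prob1 avoid_prob_ge0.
Qed.

(** A union bound in algebraic form: by Pascal's rule one step lowers the numerator by at most
    ['C(P.-1, K.-1)], which is the fraction [K / P] of ['C(P, K)]. *)
Lemma avoid_prob_ge_linear b : 1 - b%:R * (K%:R / P%:R) <= avoid_prob b.
Proof.
elim: b => [|b IH]; first by rewrite avoid_prob0 mul0r subr0.
suff : avoid_prob b - K%:R / P%:R <= avoid_prob b.+1.
  by apply: le_trans; rewrite -natr1; lra.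
rewrite /avoid_prob.
have -> : K%:R / P%:R = 'C(P.-1, K.-1)%:R / 'C(P, K)%:R :> R.
  have /(congr1 (fun x => x%:R : R)) := mul_bin_diag P K.-1.
  rewrite prednK // !natrM => E.
  have P0 := lt0r_neq0 pool_gt0.
  apply: (@mulfI _ P%:R) => //; rewrite mulrCA divff // mulr1 mulrA E mulfK //.
  exact: bin_neq0.
rewrite -mulrBl ler_pM2r ?invr_gt0 ?ltr0n ?bin_gt0 // lerBlDr -natrD ler_nat.
rewrite subnS; case E: (P - b)%N => [|m] /=; first by lia.
case: K K_gt0 => // k _; rewrite binS /= leq_add2l.
by apply: leq_bin2l; lia.
Qed.

End Uniform.

(** * Nodes of low degree *)

(* [few_prob q m a] is the probability that a binomial variable with [m] trials
   and success probability [1 - q] is smaller than [a]. *)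
Fixpoint few_prob (R : realFieldType) (q : R) (m a : nat) : R :=
  if m is m'.+1 then q * few_prob q m' a + (1 - q) * few_prob q m' a.-1
  else (0 < a)%:R.

Section FewProb.
Variables (R : realFieldType) (q : R).
Hypothesis q01 : 0 <= q <= 1.

Let q_ge0 : 0 <= q. Proof. by case/andP: q01. Qed.
Let p_ge0 : 0 <= 1 - q. Proof. by case/andP: q01 => _; lra. Qed.

Lemma few_prob_ge0 m a : 0 <= few_prob q m a.
Proof.
elim: m a => [|m IH] a /=; first exact: ler0n.
by apply: addr_ge0; apply: mulr_ge0.
Qed.

Lemma few_prob_a0 m : few_prob q m 0 = 0.
Proof. by elim: m => //= m ->; rewrite !mulr0 addr0. Qed.

Lemma few_prob_a1 m : few_prob q m 1 = q ^+ m.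
Proof. by elim: m => //= m ->; rewrite few_prob_a0 mulr0 addr0 exprS. Qed.

(** Only the event of exactly [a] successes is kept, with [q ^+ m] in place of the larger
    [q ^+ (m - a)]; this weaker power lets Pascal's rule drive the induction. *)
Lemma few_prob_ge m a : 'C(m, a)%:R * (1 - q) ^+ a * q ^+ m <= few_prob q m a.+1.
Proof.
elim: m a => [|m IH] [|a] /=.
- by rewrite bin0 !expr0 !mulr1.
- by rewrite bin0n !mul0r.
- by rewrite bin0 expr0 few_prob_a1 few_prob_a0 !mul1r exprS mulr0 addr0.
rewrite binS natrD -mulrA mulrDl !mulrA; apply: lerD.
  by rewrite [q ^+ _]exprS mulrCA ler_wpM2l.
apply: (@le_trans _ _ ((1 - q) * ('C(m, a)%:R * (1 - q) ^+ a * q ^+ m))).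
  have [m0 mp] : 0 <= q ^+ m.+1 /\ q ^+ m.+1 <= q ^+ m.
    split; first exact: exprn_ge0.
    by rewrite exprS ler_piMl ?exprn_ge0 //; case/andP: q01.
  have c0 : 0 <= 'C(m, a)%:R * (1 - q) ^+ a.+1.
    by rewrite mulr_ge0 ?ler0n ?exprn_ge0.
  rewrite [X in _ <= X](_ : _ = 'C(m, a)%:R * (1 - q) ^+ a.+1 * q ^+ m).
    exact: ler_wpM2l.
  by rewrite exprS; ring.
by apply: ler_wpM2l.
Qed.

End FewProb.

Section LowDegree.
Variables (R : realFieldType) (I : finType) (P K : nat).
Hypotheses (K_gt0 : (0 < K)%N) (leKP : (K <= P)%N).

Local Notation mu := (unif_pmf R (K_subsets P K)).
Local Notation assignment := {ffun I -> {set 'I_P}}.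
Local Notation E := (expect (I := I) mu).
Local Notation q := (avoid_prob R P K K).

Definition hits (S : assignment) (u : I) (s : seq I) : nat :=
  count (fun w => S w :&: S u != set0) s.

(** Independence from the coordinates in [s], expressed as invariance under redrawing them. *)
Definition ignores (G : assignment -> R) (s : seq I) : Prop :=
  forall w S x, w \in s -> G (upd S w x) = G S.

Lemma avoid_prob_le1 b : avoid_prob R P K b <= 1.
Proof.
apply: (le_trans (avoid_prob_le_expn _ leKP K_gt0 b)).
have P0 := pool_gt0 R leKP K_gt0.
have r0 : 0 <= K%:R / P%:R :> R by rewrite divr_ge0 ?ler0n.
have r1 : K%:R / P%:R <= 1 :> R by rewrite ler_pdivrMr // mul1r ler_nat.
by apply: exprn_ile1; lra.
Qed.

Let q01 : 0 <= q <= 1.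
Proof. by rewrite avoid_prob_ge0 avoid_prob_le1. Qed.

Lemma hits_upd S w x u s : w \notin s -> u != w -> hits (upd S w x) u s = hits S u s.
Proof.
move=> ws uw; apply: eq_in_count => v vs /=.
by rewrite !upd_other //; apply: contraNneq ws => <-.
Qed.

Lemma ignores_hits u s s' a :
  u \notin s' -> (forall w, w \in s' -> w \notin s) ->
  ignores (fun S => (hits S u s < a)%:R) s'.
Proof.
move=> us' ss' w S x ws'; rewrite hits_upd ?ss' //.
by apply: contraNneq us' => ->.
Qed.

Lemma ignoresM F G s :
  ignores F s -> ignores G s -> ignores (fun S => F S * G S) s.
Proof. by move=> iF iG w S x ws; rewrite iF // iG. Qed.

Lemma hits_cons S w x u s : w \notin s -> u != w ->
  hits (upd S w x) u (w :: s) = ((x :&: S u != set0) + hits S u s)%N.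
Proof.
by move=> ws uw; rewrite /= -(hits_upd S x ws uw) /hits /= upd_same upd_other.
Qed.

(** The recursion of [few_prob] at the level of indicators. At [a = 0] both sides vanish, so the
    truncated [a.-1] does no harm. *)
Lemma hits_cons_lt S w x u s a : w \notin s -> u != w ->
  (hits (upd S w x) u (w :: s) < a)%:R =
  (x :&: S u == set0)%:R * (hits S u s < a)%:R +
  (1 - (x :&: S u == set0)%:R) * (hits S u s < a.-1)%:R :> R.
Proof.
move=> ws uw; rewrite hits_cons //; case: eqP => _ /=.
  by rewrite subrr mul0r mul1r addr0.
by rewrite subr0 mul0r mul1r add0r; congr ((nat_of_bool _)%:R); apply/idP/idP; lia.
Qed.

(** Given [S u], which has [K] objects, the members of [s] meet it independently with probability
    [1 - q]. They are redrawn one by one, while the factor [G] does not see them. *)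
Lemma expect_few_hits u s a G : uniq s -> u \notin s -> ignores G s ->
  E (fun S => G S * (hits S u s < a)%:R) = E G * few_prob q (size s) a.
Proof.
elim: s a G => [|w s IH] a G /=.
  move=> _ _ _; rewrite -[RHS]mulrC -expectZ; apply: eq_bigr => S _.
  by rewrite [G S * _]mulrC.
move=> /andP[ws us]; rewrite inE negb_or => /andP[uw nus] iG.
have iG' : ignores G s by move=> v S x vs; apply: iG; rewrite inE vs orbT.
rewrite (expect_resample (unif_pmf_sum R leKP) w).
transitivity (E (fun S => q * (G S * (hits S u s < a)%:R) +
                          (1 - q) * (G S * (hits S u s < a.-1)%:R))).
  apply: (expect_eq (@unif_pmf_ge0 R P K)) => S HS.
  transitivity (\sum_x ((mu x * (x :&: S u == set0)%:R) *
      (G S * ((hits S u s < a)%:R - (hits S u s < a.-1)%:R)) +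
      mu x * (G S * (hits S u s < a.-1)%:R))).
    apply: eq_bigr => x _.
    by rewrite iG ?inE ?eqxx // hits_cons_lt //; ring.
  rewrite big_split /= -!mulr_suml unif_pmf_avoid // unif_pmf_sum //.
  by rewrite (unif_pmf_card (HS u)); ring.
by rewrite expectD !expectZ !IH //; ring.
Qed.

Let lt_pred_indicator (h a : nat) : (h < a.-1)%:R <= (h < a)%:R :> R.
Proof.
by rewrite ler_nat; case: (ltnP h a.-1) => // H; have -> : (h < a)%N by lia.
Qed.

(* For disjoint [S u] and [S v] the events that [S w] meets [S u] and that it
   meets [S v] are negatively correlated. *)
Lemma expect_few_hits_pair u v s a b G :
  uniq s -> u \notin s -> v \notin s -> ignores G s ->
  (forall S, 0 <= G S) -> (forall S, G S != 0 -> S u :&: S v = set0) ->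
  E (fun S => G S * ((hits S u s < a)%:R * (hits S v s < b)%:R))
  <= E G * (few_prob q (size s) a * few_prob q (size s) b).
Proof.
elim: s a b G => [|w s IH] a b G /=.
  move=> _ _ _ _ _ _; rewrite -[X in _ <= X]mulrC -expectZ; apply: (expect_le (@unif_pmf_ge0 R P K)) => S _.
  by rewrite mulrC.
move=> /andP[ws us]; rewrite !inE !negb_or => /andP[uw nus] /andP[vw nvs] iG G0 Gd.
have iG' : ignores G s by move=> t S x ts; apply: iG; rewrite inE ts orbT.
rewrite (expect_resample (unif_pmf_sum R leKP) w).
pose A c S : R := (hits S u s < c)%:R; pose B c S : R := (hits S v s < c)%:R.
apply: (@le_trans _ _ (E (fun S =>
   q * q * (G S * (A a S * B b S)) + (q * (1 - q) * (G S * (A a S * B b.-1 S)) +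
   ((1 - q) * q * (G S * (A a.-1 S * B b S)) +
   (1 - q) * (1 - q) * (G S * (A a.-1 S * B b.-1 S))))))).
  apply: (expect_le (@unif_pmf_ge0 R P K)) => S HS.
  have [GS0|GSn0] := eqVneq (G S) 0.
    rewrite GS0 big1 => [|x _]; first by rewrite !mul0r !mulr0 !addr0.
    by rewrite iG ?inE ?eqxx // GS0 mul0r mulr0.
  have Suv := Gd _ GSn0.
  have -> : \sum_x mu x * (G (upd S w x) * ((hits (upd S w x) u (w :: s) < a)%:R
       * (hits (upd S w x) v (w :: s) < b)%:R)) =
    \sum_x (mu x * (x :&: (S u :|: S v) == set0)%:R *
        (G S * ((A a S - A a.-1 S) * (B b S - B b.-1 S))) +
      (mu x * (x :&: S u == set0)%:R * (G S * ((A a S - A a.-1 S) * B b.-1 S)) +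
      (mu x * (x :&: S v == set0)%:R * (G S * (A a.-1 S * (B b S - B b.-1 S))) +
      mu x * (G S * (A a.-1 S * B b.-1 S))))).
    apply: eq_bigr => x _; rewrite iG ?mem_head //.
    rewrite (hits_cons_lt S x a ws uw) (hits_cons_lt S x b ws vw).
    rewrite -/(A a S) -/(A a.-1 S) -/(B b S) -/(B b.-1 S).
    by rewrite setIUr setU_eq0 -mulnb natrM; ring.
  rewrite !big_split /= -!mulr_suml !unif_pmf_avoid // unif_pmf_sum //.
  rewrite cardsU Suv cards0 subn0 (unif_pmf_card (HS u)) (unif_pmf_card (HS v)).
  (* The disjoint union has [K + K] objects. The two sides differ only in the probability of missing
     it against [q * q], and the coefficient is a product of nonnegative differences. *)
  have qq := avoid_probD R leKP K_gt0 K K.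
  have AA : A a.-1 S <= A a S by exact: lt_pred_indicator.
  have BB : B b.-1 S <= B b S by exact: lt_pred_indicator.
  rewrite -subr_ge0.
  rewrite (_ : _ - _ = (q * q - avoid_prob R P K (K + K)) *
     (G S * ((A a S - A a.-1 S) * (B b S - B b.-1 S)))); last by ring.
  by rewrite !mulr_ge0 ?subr_ge0.
rewrite !expectD !expectZ.
set fa := few_prob q _ a; set fa' := few_prob q _ a.-1.
set fb := few_prob q _ b; set fb' := few_prob q _ b.-1.
have q0 : 0 <= q by case/andP: q01.
have p0 : 0 <= 1 - q by case/andP: q01 => _; rewrite subr_ge0.
rewrite [X in _ <= X](_ : _ = q * q * (E G * (fa * fb)) +
  (q * (1 - q) * (E G * (fa * fb')) + ((1 - q) * q * (E G * (fa' * fb)) +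
    (1 - q) * (1 - q) * (E G * (fa' * fb'))))); last by ring.
have IHab c d : E (fun S => G S * (A c S * B d S)) <=
    E G * (few_prob q (size s) c * few_prob q (size s) d) by exact: IH.
apply: lerD; last apply: lerD; last apply: lerD.
all: by apply: ler_wpM2l; [rewrite mulr_ge0|exact: IHab].
Qed.

End LowDegree.

(** * Second moment of the number of low nodes *)

Section SecondMoment.
Variables (R : realFieldType) (I : finType) (P K k : nat) (V1 : {set I}).
Hypotheses (K_gt0 : (0 < K)%N) (leKP : (K <= P)%N).

Local Notation mu := (unif_pmf R (K_subsets P K)).
Local Notation assignment := {ffun I -> {set 'I_P}}.
Local Notation E := (expect (I := I) mu).
Local Notation q := (avoid_prob R P K K).

(* Asking for no neighbour at all inside [V1] makes the object sets of two such
   nodes disjoint, so that the second moment factorizes. *)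
Definition low (u : I) (S : assignment) : bool :=
  (hits S u (enum (V1 :\ u)) < 1)%N && (hits S u (enum (~: V1)) < k)%N.

Definition low_prob : R := q ^+ #|V1|.-1 * few_prob q #|~: V1| k.

Lemma hits_enum (S : assignment) u (A : {set I}) :
  hits S u (enum A) = #|[set w in A | S w :&: S u != set0]|.
Proof.
rewrite /hits -sum1_count -sum1_card big_enum_cond /=.
by apply: eq_bigl => w; rewrite inE.
Qed.

Lemma expect_low u : u \in V1 -> E (fun S => (low u S)%:R) = low_prob.
Proof.
move=> uV1.
transitivity (E (fun S => (1 * (hits S u (enum (V1 :\ u)) < 1)%:R) *
                        (hits S u (enum (~: V1)) < k)%:R)).
  by apply: eq_bigr => S _; rewrite mul1r -natrM mulnb.
rewrite (expect_few_hits K_gt0 leKP) ?enum_uniq //; first last.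
- apply: ignoresM => // w S x; apply: ignores_hits; first by rewrite mem_enum !inE uV1.
  by move=> v; rewrite !mem_enum !inE => /negbTE->; rewrite andbF.
- by rewrite mem_enum !inE uV1.
rewrite (expect_few_hits K_gt0 leKP) ?enum_uniq //; last by rewrite mem_enum !inE eqxx.
rewrite expect1 ?unif_pmf_sum // mul1r few_prob_a1 /low_prob -!cardE.
by have := cardsD1 u V1; rewrite uV1 => ->.
Qed.

Lemma expect_disjoint u v : u != v ->
  E (fun S => (S u :&: S v == set0)%:R) = q.
Proof.
move=> uv; rewrite (expect_resample (unif_pmf_sum R leKP) u).
rewrite -[RHS](expect_cst I (unif_pmf_sum R leKP)).
apply: (expect_eq (@unif_pmf_ge0 R P K)) => S HS.
rewrite -[X in _ = avoid_prob _ _ _ X](unif_pmf_card (HS v)) -unif_pmf_avoid //.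
by apply: eq_bigr => x _; rewrite upd_same upd_other // eq_sym.
Qed.

(** Two low nodes have disjoint object sets, which costs one factor [q]; the pair bound is then
    applied over the complement of [V1] and over the rest of [V1]. The square of the single
    probability has [q ^+ 2] here, hence the later loss [1 / q]. *)
Lemma expect_low_pair u v : u \in V1 -> v \in V1 -> u != v ->
  E (fun S => (low u S)%:R * (low v S)%:R)
  <= q * (q ^+ #|V1|.-2 * few_prob q #|~: V1| k) ^+ 2.
Proof.
move=> uV1 vV1 uv; set s := enum (V1 :\ u :\ v); set t := enum (~: V1).
have us : u \notin s by rewrite mem_enum !inE eqxx !andbF.
have vs : v \notin s by rewrite mem_enum !inE eqxx.
have ut : u \notin t by rewrite mem_enum !inE uV1.
have vt : v \notin t by rewrite mem_enum !inE vV1.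
have st w : w \in t -> w \notin s.
  by rewrite !mem_enum !inE => /negbTE->; rewrite !andbF.
have sz_s : size s = #|V1|.-2.
  rewrite -cardE; have := cardsD1 u V1; have := cardsD1 v (V1 :\ u).
  by rewrite !inE uV1 vV1 eq_sym uv /=; lia.
have sz_t : size t = #|~: V1| by rewrite -cardE.
pose D (S : assignment) : R := (S u :&: S v == set0)%:R.
have iD r : u \notin r -> v \notin r -> ignores D r.
  move=> ur vr w S x wr; rewrite /D !upd_other //.
    by apply: contraNneq vr => ->.
  by apply: contraNneq ur => ->.
have D0 S : 0 <= D S by exact: ler0n.
have Dn0 S : D S != 0 -> S u :&: S v = set0.
  by rewrite /D pnatr_eq0 eqb0 negbK => /eqP.
pose G S : R := D S * ((hits S u s < 1)%:R * (hits S v s < 1)%:R).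
apply: (@le_trans _ _ (E (fun S => G S * ((hits S u t < k)%:R * (hits S v t < k)%:R)))).
  apply: (expect_le (@unif_pmf_ge0 R P K)) => S _.
  rewrite /G /D -!natrM !mulnb ler_nat.
  case lu: (low u S) => //; case lv: (low v S) => //=.
  case/andP: lu => h1 h2; case/andP: lv => h3 h4.
  rewrite -/t in h2 h4; rewrite h2 h4 andbT.
  have sub a b : (hits S a (enum (V1 :\ a)) < 1)%N -> b \in V1 :\ a -> S b :&: S a == set0.
    rewrite ltnS leqn0 hits_enum cards_eq0 => /eqP/setP/(_ b).
    by rewrite !inE => H /andP[ba bV]; move: H; rewrite ba bV /= => /negbFE.
  have subs a : a \in [:: u; v] -> (hits S a (enum (V1 :\ a)) < 1)%N -> (hits S a s < 1)%N.
    move=> auv ha; rewrite ltnS leqn0 hits_enum cards_eq0; apply/eqP/setP => w.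
    rewrite !inE; apply/negP => /andP[/and3P[wv wu wV]].
    rewrite (eqP (sub a w ha _)) ?eqxx // !inE wV andbT.
    by move: auv; rewrite !inE => /orP[]/eqP->.
  rewrite !subs ?inE ?eqxx ?orbT //= andbT setIC sub //.
  by rewrite !inE eq_sym uv vV1.
apply: (@le_trans _ _ (E G * (few_prob q (size t) k * few_prob q (size t) k))).
  apply: expect_few_hits_pair; rewrite ?enum_uniq //.
  - apply: ignoresM; first exact: iD.
    by apply: ignoresM; apply: ignores_hits.
  - by move=> S; rewrite mulr_ge0 // mulr_ge0 ?ler0n.
  - by move=> S; rewrite mulf_eq0 negb_or => /andP[/Dn0].
have q0 : 0 <= q by exact: avoid_prob_ge0.
have q1 : q <= 1 by exact: avoid_prob_le1.
have f0 : 0 <= few_prob q (size t) k by apply: few_prob_ge0; rewrite q0.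
apply: (@le_trans _ _ (E D * (few_prob q (size s) 1 * few_prob q (size s) 1) *
                       (few_prob q (size t) k * few_prob q (size t) k))).
  apply: ler_wpM2r; first exact: mulr_ge0.
  by apply: expect_few_hits_pair; rewrite ?enum_uniq //; exact: iD.
by rewrite expect_disjoint // few_prob_a1 sz_s sz_t expr2 -!mulrA [few_prob _ _ _ * (_ * _)]mulrCA.
Qed.

Let pair_identity (x f : R) m : 0 < x -> (1 < m)%N ->
  x * (x ^+ m.-2 * f) ^+ 2 = (x ^+ m.-1 * f) ^+ 2 / x.
Proof.
case: m => [|[|m]] //= x0 _; rewrite [x ^+ m.+1]exprS; move: (x ^+ m) => y.
by field; rewrite gt_eqF.
Qed.

(** Chebyshev's inequality for the number [X] of low nodes, of mean [m]: the diagonal contributes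
    [m] to the second moment, the other pairs at most [m ^+ 2 / q]. *)
Lemma prob_no_low_le : 0 < q -> 0 < #|V1|%:R * low_prob ->
  E (fun S => (~~ [exists u in V1, low u S])%:R)
  <= (#|V1|%:R * low_prob)^-1 + (q^-1 - 1).
Proof.
move=> q0 m0; set m := _ * low_prob.
pose X (S : assignment) : R := \sum_(u in V1) (low u S)%:R.
have EX : E X = m.
  rewrite expect_sum (eq_bigr (fun=> low_prob)); last by move=> u; exact: expect_low.
  by rewrite sumr_const /m mulr_natl.
have EX2 : E (fun S => X S * X S) <= m + m ^+ 2 / q.
  rewrite (_ : E _ = \sum_(u in V1) \sum_(v in V1) E (fun S => (low u S)%:R * (low v S)%:R)).
    rewrite (_ : m + _ = \sum_(u in V1) (low_prob + #|V1|%:R * low_prob ^+ 2 / q)); last first.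
      by rewrite sumr_const -[RHS]mulr_natl /m; ring.
    apply: ler_sum => u uV1; rewrite (bigD1 u) //=; apply: lerD.
      rewrite -(expect_low uV1); apply: (expect_le (@unif_pmf_ge0 R P K)) => S _.
      by rewrite -natrM mulnb andbb.
    apply: (@le_trans _ _ (\sum_(v in V1 | v != u) (low_prob ^+ 2 / q))).
      apply: ler_sum => v /andP[vV1 vu].
      apply: (le_trans (expect_low_pair uV1 vV1 _)); first by rewrite eq_sym.
      rewrite pair_identity //; have := cardsD1 u V1; have := cardsD1 v (V1 :\ u).
      by rewrite !inE uV1 vV1 vu /=; lia.
    rewrite -mulrA mulr_natl -sumr_const big_mkcondr /=; apply: ler_sum => v _.
    by case: ifP => // _; rewrite divr_ge0 ?exprn_even_ge0 // ltW.
  transitivity (E (fun S => \sum_(u in V1) \sum_(v in V1) (low u S)%:R * (low v S)%:R)).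
    apply: eq_bigr => S _; congr (_ * _).
    by rewrite /X mulr_suml; apply: eq_bigr => u _; exact: mulr_sumr.
  by rewrite expect_sum; apply: eq_bigr => u _; rewrite expect_sum.
have : m ^+ 2 * E (fun S => (~~ [exists u in V1, low u S])%:R) <= m + m ^+ 2 / q - m ^+ 2.
  rewrite -expectZ.
  (* The right side is [(X - m) ^+ 2] expanded, equal to [m ^+ 2] when no node is low. *)
  apply: (@le_trans _ _ (E (fun S => X S * X S + (- (2 * m) * X S + m ^+ 2 * 1)))).
    apply: (expect_le (@unif_pmf_ge0 R P K)) => S _.
    case: existsP => /= [_|nlow].
      rewrite mulr0 (_ : _ + _ = (X S - m) ^+ 2); last by ring.
      by rewrite exprn_even_ge0.
    have -> : X S = 0.
      apply: big1 => u uV1; case lu: (low u S) => //; case: nlow; exists u.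
      by rewrite uV1.
    by rewrite !mulr0 !add0r.
  rewrite !expectD !expectZ EX expect1 ?unif_pmf_sum //.
  by rewrite -subr_ge0; move: EX2; rewrite -subr_ge0; congr (0 <= _); ring.
have -> : m + m ^+ 2 / q - m ^+ 2 = m ^+ 2 * (m^-1 + (q^-1 - 1)).
  by field; rewrite !gt_eqF.
by rewrite ler_pM2l // exprn_gt0.
Qed.

End SecondMoment.

(** * Low nodes and failure of robustness *)

Lemma prob_robust_expect (R : realFieldType) n P K k :
  prob_k_robust R n P K k =
  expect (I := 'I_n) (unif_pmf R (K_subsets P K))
    (fun S => (k_robust (intersection_graph S) k)%:R).
Proof.
rewrite /prob_k_robust /assignment_prob big_mkcond /=; apply: eq_bigr => S _.
by rewrite /assignment_pmf; case: ifP => _; rewrite ?mulr1 ?mulr0.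
Qed.

(** The cut is [[set u]]. Seen from [u], the degree is below [k]. A node outside has at most one
    neighbour in the cut, which matters only for [k = 1], and then [u] would be both isolated and
    adjacent to it. *)
Lemma low_not_robust n P k (V1 : {set 'I_n}) (S : {ffun 'I_n -> {set 'I_P}}) u :
  (1 < n)%N -> (0 < k)%N -> u \in V1 -> low k V1 u S ->
  ~~ k_robust (intersection_graph S) k.
Proof.
move=> n1 k0 uV1 /andP[h1 h2]; apply/negP => /forallP/(_ [set u]).
have degu : (#|nbrs_in (intersection_graph S) u (~: [set u])| < k)%N.
  apply: leq_ltn_trans h2; rewrite -[X in (_ <= X)%N]add0n.
  move: h1; rewrite ltnS leqn0 => /eqP <-; rewrite !hits_enum.
  apply: leq_trans (leq_card_setU _ _); apply: subset_leq_card.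
  apply/subsetP => w; rewrite !inE => /and3P[-> _ uw]; rewrite setIC uw !andbT.
  by case: (w \in V1).
have -> : ([set u] != set0) && ([set u] \proper [set: 'I_n]).
  rewrite -cards_eq0 cards1 properE subsetT /=.
  by apply/negP => /subset_leq_card; rewrite cardsT card_ord cards1; lia.
move=> /= /orP[/existsP[v /andP[]]|/existsP[w /andP[wu]]].
  by rewrite inE => /eqP->; rewrite leqNgt degu.
have [eq0 k_le|/set0Pn[v]] := eqVneq (nbrs_in (intersection_graph S) w [set u]) set0.
  by move: k_le; rewrite eq0 cards0; lia.
rewrite !inE => /andP[/eqP-> ]; rewrite -/(intersection_graph S w u) => wue.
have : (#|nbrs_in (intersection_graph S) w [set u]| <= 1)%N.
  rewrite -(cards1 u); apply: subset_leq_card; apply/subsetP => x.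
  by rewrite inE => /andP[].
have : (0 < #|nbrs_in (intersection_graph S) u (~: [set u])|)%N.
  rewrite card_gt0; apply/set0Pn; exists w.
  by rewrite inE wu intersection_graph_sym.
move=> d0 d1 dk; have := leq_trans d0 (leq_trans degu (leq_trans dk d1)).
by rewrite ltnn.
Qed.

Lemma prob_robust_le (R : realFieldType) n P K k (V1 : {set 'I_n}) :
  (1 < n)%N -> (0 < k)%N -> (0 < K <= P)%N ->
  0 < avoid_prob R P K K -> 0 < #|V1|%:R * low_prob R P K k V1 ->
  prob_k_robust R n P K k
  <= (#|V1|%:R * low_prob R P K k V1)^-1 + ((avoid_prob R P K K)^-1 - 1).
Proof.
move=> n1 k0 /andP[K0 leKP] q0 m0.
rewrite prob_robust_expect; apply: le_trans (prob_no_low_le K0 leKP q0 m0).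
apply: (expect_le (@unif_pmf_ge0 R P K)) => S _; rewrite ler_nat.
case rob: (k_robust _ _) => //; case: existsP => // -[u /andP[uV1 lu]].
by have := low_not_robust n1 k0 uV1 lu; rewrite rob.
Qed.

(** * Sets with few outgoing edges *)

Section Overlap.
Variables (I : finType) (P : nat) (S : {ffun I -> {set 'I_P}}).

Definition overlap (W : {set I}) : nat :=
  (\sum_(i in W) \sum_(j in W | j != i) #|S i :&: S j|)%N.

Lemma overlap_mono (W W' : {set I}) : W \subset W' -> (overlap W <= overlap W')%N.
Proof.
move=> sub; rewrite /overlap big_mkcond [leqRHS]big_mkcond /=.
apply: leq_sum => i _; case: ifP => // iW; rewrite (subsetP sub _ iW).
rewrite big_mkcond [leqRHS]big_mkcond /=.
apply: leq_sum => j _; case: ifP => // /andP[jW ->].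
by rewrite (subsetP sub _ jW).
Qed.

Lemma card_capU_le (A : {set 'I_P}) (s : seq I) :
  (#|A :&: \bigcup_(j <- s) S j| <= \sum_(j <- s) #|A :&: S j|)%N.
Proof.
elim: s => [|a s IH]; first by rewrite !big_nil setI0 cards0.
rewrite !big_cons setIUr; apply: leq_trans (leq_card_setU _ _) _.
by rewrite leq_add2l.
Qed.

(** A Bonferroni inequality with ordered pairs: a further set enlarges the union by its size minus
    at most its intersections with the sets already there. *)
Lemma sum_card_le_union_overlap (s : seq I) : uniq s ->
  (\sum_(i <- s) #|S i| <=
   #|\bigcup_(i <- s) S i| + \sum_(i <- s) \sum_(j <- s | j != i) #|S i :&: S j|)%N.
Proof.
elim: s => [|a s IH] /=; first by rewrite !big_nil.
move=> /andP[as_ us]; rewrite !big_cons eqxx /= cardsU.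
have := card_capU_le (S a) s.
have -> : (\sum_(j <- s | j != a) #|S a :&: S j| = \sum_(j <- s) #|S a :&: S j|)%N.
  rewrite big_seq_cond [RHS]big_seq; apply: eq_bigl => j.
  by case js: (j \in s) => //=; apply: contraNneq as_ => <-.
have : (\sum_(i <- s) \sum_(j <- s | j != i) #|S i :&: S j| <=
        \sum_(i <- s) \sum_(j <- a :: s | j != i) #|S i :&: S j|)%N.
  by apply: leq_sum => i _; rewrite big_cons; case: ifP => // _; exact: leq_addl.
have : (#|S a :&: \bigcup_(j <- s) S j| <= #|S a|)%N.
  by apply: subset_leq_card; exact: subsetIl.
have := IH us.
set x := (\sum_(i <- s) #|S i|)%N; set u := #|\bigcup_(i <- s) S i|.
set o := (\sum_(i <- s) _)%N; set o' := (\sum_(i <- s) \sum_(j <- a :: s | _) _)%N.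
set c := #|S a :&: _|; set d := (\sum_(j <- s) #|S a :&: S j|)%N; set z := #|S a|.
by move: x u o o' c d z => x u o o' c d z; lia.
Qed.

Lemma card_union_ge (K : nat) (W : {set I}) (s : seq I) :
  (forall i, #|S i| = K) -> uniq s -> {subset s <= W} ->
  (K * size s <= #|\bigcup_(i <- s) S i| + overlap W)%N.
Proof.
move=> SK us sW; have -> : (K * size s = \sum_(i <- s) #|S i|)%N.
  by rewrite (eq_bigr (fun=> K)) // big_const_seq count_predT iter_addn_0.
apply: (leq_trans (sum_card_le_union_overlap us)); rewrite leq_add2l.
have sWs : [set i in s] \subset W by apply/subsetP => i; rewrite inE => /sW.
apply: leq_trans (overlap_mono sWs).
rewrite /overlap [leqLHS]big_uniq //= [leqRHS](eq_bigl (mem s)); last first.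
  by move=> i; rewrite inE.
apply: leq_sum => i _; rewrite -big_filter big_uniq ?filter_uniq //=.
rewrite [leqRHS](eq_bigl (mem [seq j <- s | j != i])) // => j.
by rewrite [RHS]mem_filter inE andbC.
Qed.

End Overlap.

(** * Probability of sending few edges into a fixed set *)

Section FewCrossing.
Variables (R : realFieldType) (I : finType) (P K : nat).
Hypotheses (K_gt0 : (0 < K)%N) (ltKP : (K < P)%N).

Let leKP : (K <= P)%N := ltnW ltKP.
Local Notation mu := (unif_pmf R (K_subsets P K)).
Local Notation assignment := {ffun I -> {set 'I_P}}.
Local Notation E := (expect (I := I) mu).

Definition keep_ratio : R := 1 - K%:R / P%:R.
Local Notation r := keep_ratio.

Let P0 : 0 < P%:R :> R. Proof. exact: (pool_gt0 R leKP K_gt0). Qed.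

Lemma keep_ratio_gt0 : 0 < r.
Proof. by rewrite /r subr_gt0 ltr_pdivrMr // mul1r ltr_nat. Qed.

Lemma keep_ratio_le1 : r <= 1.
Proof. by rewrite /r gerBl divr_ge0 ?ler0n. Qed.

(* The threshold [P %/ (2 * K)] for the overlap costs a factor 2 only. *)
Lemma keep_ratio_threshold : 2^-1 <= r ^+ (P %/ (2 * K)).
Proof.
have x01 : 0 <= (K%:R / P%:R : R) <= 1.
  by rewrite divr_ge0 ?ler0n // ler_pdivrMr // mul1r ler_nat.
apply: le_trans (bernoulli_ineq _ x01).
have : (P %/ (2 * K))%:R * (K%:R / P%:R) <= 2^-1 :> R.
  rewrite mulrA ler_pdivrMr // mulrC ler_pdivlMl // -!natrM ler_nat.
  by have := leq_trunc_div P (2 * K); lia.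
by lra.
Qed.

(** Each node contributes the factor [y] plus [1 - y] times the indicator of a miss. On expansion, a
    set of [d] misses has probability at most [r] to the size of the union of its object sets, hence
    at most [2 * r ^+ (K * d)] by the overlap bound, and the sum folds back into a product. *)
Lemma expect_hits_pow (S : assignment) (W : {set I}) (y : R) :
  0 <= y <= 1 -> (forall i, #|S i| = K) -> (overlap S W <= P %/ (2 * K))%N ->
  \sum_x mu x * y ^+ count (fun w => S w :&: x != set0) (enum W)
  <= 2 * (y + (1 - y) * r ^+ K) ^+ #|W|.
Proof.
move=> /andP[y0 y1] SK ov.
have r0 := keep_ratio_gt0; have r1 := keep_ratio_le1.
(* The nodes of [s] still carry their factor; those of [D] are required to be missed. *)
pose Phi (s D : seq I) := \sum_x mu x * ((x :&: \bigcup_(i <- D) S i == set0)%:R *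
   y ^+ count (fun w => S w :&: x != set0) s).
suff main s D : uniq (D ++ s) -> {subset D ++ s <= W} ->
    Phi s D <= 2 * ((r ^+ K) ^+ size D * (y + (1 - y) * r ^+ K) ^+ size s).
  have := main (enum W) [::]; rewrite /= enum_uniq expr0 mul1r -cardE => H.
  apply: le_trans (H _ _) => //; last by move=> i; rewrite mem_enum.
  by rewrite /Phi big_nil; apply: ler_sum => x _; rewrite setI0 eqxx mul1r.
elim: s D => [|w s IH] D uD sD.
  rewrite /Phi /= expr0 mulr1; under eq_bigr do rewrite mulr1.
  rewrite unif_pmf_avoid //; apply: (le_trans (avoid_prob_le_expn R leKP K_gt0 _)).
  rewrite -/r -exprM cats0 in uD sD *.
  have H := card_union_ge SK uD sD.
  set u := #|_| in H *.
  have : r ^+ (u + P %/ (2 * K)) <= r ^+ (K * size D).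
    apply: ler_wiXn2l; [exact: ltW|exact: r1|].
    by apply: leq_trans H _; rewrite leq_add2l.
  have ru : 0 <= r ^+ u by rewrite exprn_ge0 // ltW.
  by have := keep_ratio_threshold; rewrite exprD; nra.
have stp : Phi (w :: s) D = y * Phi s D + (1 - y) * Phi s (w :: D).
  rewrite /Phi !mulr_sumr -big_split; apply: eq_bigr => x _ /=.
  rewrite big_cons setIUr setU_eq0 -mulnb natrM [x :&: S w]setIC exprD.
  by case: (S w :&: x == set0); rewrite /= ?expr0 ?expr1; ring.
have p1 : uniq (D ++ s) && ((w \notin D) && (w \notin s)).
  by move: uD; rewrite cat_uniq /= negb_or cat_uniq => /and3P[-> /andP[-> ->] /andP[-> ->]].
case/and3P: p1 => uDs wD ws.
rewrite stp; set g := y + _; set c := r ^+ K.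
have -> : 2 * (c ^+ size D * g ^+ size (w :: s)) =
   y * (2 * (c ^+ size D * g ^+ size s)) + (1 - y) * (2 * (c ^+ size (w :: D) * g ^+ size s)).
  by rewrite /= !exprS /g -/c; ring.
apply: lerD; apply: ler_wpM2l; rewrite ?subr_ge0 //; apply: IH => //.
- move=> i; rewrite mem_cat => iDs; apply: sD.
  by rewrite mem_cat inE; case/orP: iDs => ->; rewrite ?orbT.
- by rewrite /= mem_cat negb_or wD ws.
- move=> i; rewrite /= inE => iDs; apply: sD; rewrite mem_cat inE.
  by move: iDs; rewrite mem_cat => /or3P[]->; rewrite ?orbT.
Qed.

Definition few_crossing_bound (y : R) (k m : nat) : R :=
  y ^- k.-1 * (2 * (y + (1 - y) * r ^+ K) ^+ m).

(** Markov's inequality: as [y <= 1], fewer than [k] hits force the power of [y] to be at least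
    [y ^+ k.-1]. *)
Lemma prob_few_crossing (S : assignment) (W : {set I}) (y : R) k :
  0 < y <= 1 -> (0 < k)%N -> (forall i, #|S i| = K) ->
  (overlap S W <= P %/ (2 * K))%N ->
  \sum_x mu x * (count (fun w => S w :&: x != set0) (enum W) < k)%:R
  <= few_crossing_bound y k #|W|.
Proof.
move=> /andP[y0 y1] k0 SK ov.
have yy : 0 <= y <= 1 by rewrite y1 ltW.
rewrite /few_crossing_bound ler_pdivlMl ?exprn_gt0 //.
apply: le_trans (expect_hits_pow yy SK ov).
rewrite mulr_sumr; apply: ler_sum => x _; rewrite mulrCA.
apply: ler_wpM2l; first exact: unif_pmf_ge0.
case: ltnP => hk; last by rewrite mulr0 exprn_ge0 // ltW.
rewrite mulr1; apply: ler_wiXn2l; [exact: ltW|exact: y1|].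
by case: k k0 hk.
Qed.

(** The overlap condition involves only coordinates in [W], which [t] avoids. Given these, the
    members of [t] act independently, and each redraw yields one factor. *)
Lemma prob_few_crossing_set (W : {set I}) (t : seq I) (y : R) k :
  0 < y <= 1 -> (0 < k)%N -> uniq t -> (forall v, v \in t -> v \notin W) ->
  E (fun S => ((overlap S W <= P %/ (2 * K))%N && all (fun v => hits S v (enum W) < k)%N t)%:R)
  <= few_crossing_bound y k #|W| ^+ size t.
Proof.
move=> y01 k0; have /andP[y0 y1] := y01; elim: t => [|v t IH] /=.
  move=> _ _; rewrite expr0 -[leRHS](expect1 I (unif_pmf_sum R leKP)).
  apply: (expect_le (@unif_pmf_ge0 R P K)) => S _.
  by rewrite lern1 leq_b1.
move=> /andP[vt ut] tW.
have vW : v \notin W by apply: tW; rewrite inE eqxx.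
have g0 : 0 <= few_crossing_bound y k #|W|.
  rewrite mulr_ge0 ?invr_ge0 ?exprn_ge0 ?ltW // mulr_gt0 // exprn_gt0 //.
  rewrite ltr_pwDl // mulr_ge0 ?subr_ge0 // exprn_ge0 // ltW //.
  exact: keep_ratio_gt0.
rewrite (expect_resample (unif_pmf_sum R leKP) v) exprS.
have tW' u : u \in t -> u \notin W by move=> h; apply: tW; rewrite inE h orbT.
apply: le_trans (ler_wpM2l g0 (IH ut tW')); rewrite -expectZ.
apply: (expect_le (@unif_pmf_ge0 R P K)) => S HS.
have SK i : #|S i| = K by exact: unif_pmf_card (HS i).
have neqW i : i \in W -> i != v by move=> iW; apply: contraNneq vW => <-.
have ovE x : overlap (upd S v x) W = overlap S W.
  apply: eq_bigr => i iW; apply: eq_bigr => j /andP[jW _].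
  by rewrite !upd_other ?neqW.
have allE x : all (fun u => hits (upd S v x) u (enum W) < k)%N t =
              all (fun u => hits S u (enum W) < k)%N t.
  apply: eq_in_all => u ut'; rewrite hits_upd ?mem_enum //.
  by apply: contraNneq vt => <-.
have hE x : hits (upd S v x) v (enum W) = count (fun w => S w :&: x != set0) (enum W).
  apply: eq_in_count => w; rewrite mem_enum => wW /=.
  by rewrite upd_same upd_other ?neqW.
under eq_bigr do rewrite ovE allE hE.
case: leqP => ov /=; last by rewrite big1 ?mulr0 // => x _; rewrite mulr0.
case: (all _ t); last first.
  by rewrite big1 ?mulr0 // => x _; rewrite andbF mulr0.
under eq_bigr do rewrite andbT.
by rewrite mulr1; exact: prob_few_crossing.
Qed.

Lemma expect_card_cap u v : u != v ->
  E (fun S => #|S u :&: S v|%:R) = K%:R ^+ 2 / P%:R.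
Proof.
move=> uv; rewrite (expect_resample (unif_pmf_sum R leKP) u).
rewrite -[RHS](expect_cst I (unif_pmf_sum R leKP)).
apply: (expect_eq (@unif_pmf_ge0 R P K)) => S HS.
transitivity (\sum_x \sum_(a in S v) mu x * (1 - (x :&: [set a] == set0)%:R)).
  apply: eq_bigr => x _; rewrite upd_same upd_other 1?eq_sym // -mulr_sumr; congr (_ * _).
  rewrite -sum1_card natr_sum (eq_bigl (fun a => (a \in S v) && (a \in x))); last first.
    by move=> a; rewrite inE andbC.
  rewrite big_mkcondr /=; apply: eq_bigr => a _.
  rewrite setI_eq0 disjoint_sym disjoints1.
  by case: (a \in x); rewrite /= ?subr0 ?subrr.
rewrite exchange_big /= (eq_bigr (fun=> K%:R / P%:R)).
  by rewrite sumr_const (unif_pmf_card (HS v)) -[LHS]mulr_natl mulrA expr2.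
move=> a _; under eq_bigr do rewrite mulrBr mulr1.
rewrite sumrB unif_pmf_sum // unif_pmf_avoid // cards1 avoid_prob1 //.
by rewrite subKr.
Qed.

(** Markov's inequality: by linearity the mean overlap is at most [#|I| ^+ 2 * K ^+ 2 / P]. *)
Lemma prob_overlap_large :
  E (fun S => (P %/ (2 * K) < overlap S [set: I])%:R)
  <= 2 * (#|I|%:R ^+ 2 * K%:R ^+ 3 / P%:R ^+ 2).
Proof.
have K0 : 0 < K%:R :> R by rewrite ltr0n.
apply: (@le_trans _ _ (E (fun S => 2 * K%:R / P%:R * (overlap S [set: I])%:R))).
  apply: (expect_le (@unif_pmf_ge0 R P K)) => S _.
  case: ltnP => H; last by rewrite mulr_ge0 ?divr_ge0 ?ler0n // mulr_ge0 ?ler0n.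
  rewrite mulrAC ler_pdivlMr // mul1r -!natrM ler_nat.
  (* Strict excess over the rounded quotient makes up for the rounding. *)
  by have := divn_eq P (2 * K); have := @ltn_pmod P (2 * K); nia.
rewrite expectZ.
have -> : 2 * (#|I|%:R ^+ 2 * K%:R ^+ 3 / P%:R ^+ 2) =
  2 * K%:R / P%:R * (#|I|%:R ^+ 2 * (K%:R ^+ 2 / P%:R)) :> R.
  by field; rewrite gt_eqF.
apply: ler_wpM2l; first by rewrite divr_ge0 ?mulr_ge0 ?ler0n.
have -> : E (fun S => (overlap S [set: I])%:R) =
  \sum_(i in [set: I]) \sum_(j in [set: I] | j != i) E (fun S => #|S i :&: S j|%:R).
  transitivity (E (fun S => \sum_(i in [set: I]) \sum_(j in [set: I] | j != i) #|S i :&: S j|%:R)).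
    apply: eq_bigr => S _; rewrite /overlap natr_sum; congr (_ * _).
    by apply: eq_bigr => i _; rewrite natr_sum.
  by rewrite expect_sum; apply: eq_bigr => i _; rewrite expect_sum.
apply: (@le_trans _ _ (\sum_(i : I) \sum_(j : I) (K%:R ^+ 2 / P%:R))).
  rewrite (eq_bigl predT); last by move=> i; rewrite inE.
  apply: ler_sum => i _; rewrite [leRHS](bigID (fun j => j != i)) /=.
  rewrite (eq_bigl (fun j => j != i)); last by move=> j; rewrite inE.
  rewrite (eq_bigr (fun=> K%:R ^+ 2 / P%:R)); last first.
    by move=> j ji; rewrite expect_card_cap // eq_sym.
  by rewrite lerDl sumr_ge0 // => j _; rewrite divr_ge0 ?exprn_ge0 ?ler0n.
by rewrite !sumr_const -mulrnA -[leLHS]mulr_natl natrM expr2.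
Qed.

End FewCrossing.

(** * Union bound over cuts *)

Lemma not_robust_few_crossing n P k (S : {ffun 'I_n -> {set 'I_P}}) :
  ~~ k_robust (intersection_graph S) k ->
  exists2 T : {set 'I_n}, (0 < #|T| <= n./2)%N &
    all (fun v => hits S v (enum (~: T)) < k)%N (enum T).
Proof.
move=> /forallPn[T]; rewrite negb_imply negb_or => /andP[/andP[T0 Tpr]].
move=> /andP[/existsPn H1 /existsPn H2].
have nbrsE (A : {set 'I_n}) v : v \in A ->
    hits S v (enum (~: A)) = #|nbrs_in (intersection_graph S) v (~: A)|.
  move=> vA; rewrite hits_enum; apply: eq_card => w.
  rewrite !inE setIC; case wA: (w \in A) => //=.
  have vw : v != w by apply: contraTneq vA => ->; rewrite wA.
  by rewrite /intersection_graph /= vw.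
have cardT : (#|T| + #|~: T| = n)%N by rewrite cardsC card_ord.
(* A failing cut fails from both sides, so the smaller side can be taken. *)
have [Th|Th] := leqP #|T| n./2.
  exists T; first by rewrite card_gt0 T0.
  apply/allP => v; rewrite mem_enum => vT; rewrite nbrsE // ltnNge.
  by have := H1 v; rewrite vT.
exists (~: T).
  have := proper_card Tpr; rewrite cardsT card_ord => ltT.
  by move: Th cardT ltT; move: (#|T|) (#|~: T|) => a b; lia.
apply/allP => v; rewrite mem_enum => vT; rewrite nbrsE // setCK ltnNge.
by have := H2 v; rewrite vT.
Qed.

Lemma sum_by_card (R : realFieldType) (n h : nat) (f : nat -> R) : (h <= n)%N ->
  \sum_(T : {set 'I_n} | (0 < #|T| <= h)%N) f #|T| =
  \sum_(1 <= t < h.+1) 'C(n, t)%:R * f t.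
Proof.
move=> hn; rewrite big_add1 /= big_mkord.
have cardT (T : {set 'I_n}) : (0 < #|T| <= h)%N -> (#|T|.-1 < h)%N by lia.
case: h hn cardT => [|h] hn cardT.
  rewrite big_ord0 big_pred0 // => T; lia.
rewrite (partition_big (fun T : {set 'I_n} => inord #|T|.-1 : 'I_h.+1) predT) //=.
apply: eq_bigr => t _.
rewrite (eq_bigl (fun T : {set 'I_n} => #|T| == t.+1)); last first.
  move=> T; apply/idP/idP.
    move=> /andP[H /eqP <-]; rewrite inordK ?cardT //.
    by case/andP: H => H _; rewrite prednK.
  move=> /eqP HT; have ht := ltn_ord t.
  rewrite HT /= ht -(inj_eq val_inj) /= inordK //.
rewrite (eq_bigr (fun=> f t.+1)); last by move=> T /eqP->.
rewrite sumr_const -[LHS]mulr_natl; congr (_%:R * _).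
by rewrite -[n in 'C(n, _)]card_ord -card_draws; apply: eq_card => T; rewrite inE.
Qed.

(** Either the graph is robust, or the total overlap is large, or some set of at most half the nodes
    is bad, so the expectations of these indicators sum to at least 1. *)
Lemma prob_robust_ge (R : realFieldType) n P K k (y : R) :
  (0 < K < P)%N -> (0 < k)%N -> 0 < y <= 1 ->
  1 - (2 * (n%:R ^+ 2 * K%:R ^+ 3 / P%:R ^+ 2) +
       \sum_(1 <= t < n./2.+1) 'C(n, t)%:R * few_crossing_bound P K y k (n - t) ^+ t)
  <= prob_k_robust R n P K k.
Proof.
move=> /andP[K0 ltKP] k0 y01; have leKP := ltnW ltKP.
rewrite prob_robust_expect; set mu := unif_pmf R _; pose E := expect (I := 'I_n) mu.
have muS : \sum_x mu x = 1 by exact: unif_pmf_sum.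
rewrite lerBlDr.
(* Only the overlap outside [T] is constrained, which keeps this condition independent of the nodes
   of [T]; monotonicity recovers it from the total overlap. *)
pose bad (T : {set 'I_n}) (S : {ffun 'I_n -> {set 'I_P}}) :=
  (overlap S (~: T) <= P %/ (2 * K))%N &&
  all (fun v => hits S v (enum (~: T)) < k)%N (enum T).
have -> : \sum_(1 <= t < n./2.+1) 'C(n, t)%:R * few_crossing_bound P K y k (n - t) ^+ t =
   \sum_(T : {set 'I_n} | (0 < #|T| <= n./2)%N) few_crossing_bound P K y k (n - #|T|) ^+ #|T|.
  rewrite (sum_by_card (fun t => few_crossing_bound P K y k (n - t) ^+ t)) //.
  by rewrite -divn2 leq_div.
rewrite -[leLHS](expect1 'I_n muS).
apply: (@le_trans _ _ (E (fun S => (k_robust (intersection_graph S) k)%:R +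
   ((P %/ (2 * K) < overlap S [set: 'I_n])%:R +
    \sum_(T : {set 'I_n} | (0 < #|T| <= n./2)%N) (bad T S)%:R)))).
  apply: (expect_le (@unif_pmf_ge0 R P K)) => S _.
  have s0 : 0 <= \sum_(T : {set 'I_n} | (0 < #|T| <= n./2)%N) (bad T S)%:R :> R.
    by rewrite sumr_ge0 // => T _; exact: ler0n.
  case: (boolP (k_robust _ _)) => [_|nrob]; first by rewrite lerDl addr_ge0 ?ler0n.
  case: ltnP => ov; first by rewrite add0r lerDl.
  rewrite !add0r; have [T T0 Tall] := not_robust_few_crossing nrob.
  rewrite (bigD1 T) //= {1}/bad Tall (leq_trans (overlap_mono _ _) ov) ?subsetT //=.
  by rewrite lerDl sumr_ge0 // => T' _; exact: ler0n.
rewrite /E !expectD expect_sum lerD2l lerD //.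
  by have := @prob_overlap_large R 'I_n P K K0 ltKP; rewrite card_ord.
apply: ler_sum => T _.
have := @prob_few_crossing_set R 'I_n P K K0 ltKP (~: T) (enum T) y k y01 k0.
rewrite -cardE enum_uniq.
have -> : #|~: T| = (n - #|T|)%N by have := cardsC T; rewrite card_ord; lia.
by apply=> // v; rewrite mem_enum inE negbK.
Qed.

Lemma exists_half_set n :
  exists V : {set 'I_n}, #|V| = n./2 /\ #|~: V| = (n - n./2)%N.
Proof.
have hn : (n./2 <= n)%N by lia.
exists [set i : 'I_n | (i < n./2)%N].
have V1E : #|[set i : 'I_n | (i < n./2)%N]| = n./2.
  rewrite -sum1_card (eq_bigl (fun i : 'I_n => (i < n./2)%N)); last first.
    by move=> i; rewrite inE.
  by rewrite -(big_ord_widen n (fun=> 1%N) hn) sum_nat_const card_ord muln1.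
split => //; have := cardsC [set i : 'I_n | (i < n./2)%N].
by rewrite card_ord V1E => e; apply/eqP; rewrite -(eqn_add2l n./2) e subnKC.
Qed.

Lemma leq_half_mul2 t n : (t <= n./2)%N -> (t * 2 <= n)%N.
Proof. by lia. Qed.

Lemma leq_of_leq_half t n : (t <= n./2)%N -> (t <= n)%N.
Proof. by lia. Qed.

Lemma leq_half_mul3 n : (3 < n)%N -> (n <= n./2 * 3)%N.
Proof. by lia. Qed.

Lemma leq_half_parts n : ((n./2).-1 + (n - n./2) <= n)%N.
Proof. by lia. Qed.

From mathcomp Require Import all_classical all_reals all_analysis.
Import numFieldNormedType.Exports.
Local Open Scope classical_set_scope.
Local Open Scope ring_scope.

(** * Elementary estimates *)

Lemma ffact_le_expn n t : (n ^_ t <= n ^ t)%N.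
Proof.
elim: t n => [|t IH] n; first by rewrite ffactn0 expn0.
case: n => [|n]; first by rewrite ffact_small.
rewrite ffactSS expnS leq_mul2l /=; apply: (leq_trans (IH n)).
by case: t {IH} => // t; rewrite leq_exp2r.
Qed.

Lemma ffact_ge_expn n j : (j <= n)%N -> ((n - j) ^ j <= n ^_ j)%N.
Proof.
elim: j n => [|j IH] [|n] // jn; rewrite ffactSS expnS subSS.
by apply: leq_mul; [lia|exact: IH].
Qed.

Section Estimates.
Variable R : realType.
Implicit Types (x y s : R) (n t k : nat).

(** The bound [(e n / t) ^ t] cleared of its denominator; [t ^ t / t!] is one term of the
    exponential series at [t]. *)
Lemma bin_mul_expn_le n t : 'C(n, t)%:R * t%:R ^+ t <= (expR 1 * n%:R) ^+ t :> R.
Proof.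
case: t => [|t]; first by rewrite bin0 !expr0 mulr1.
have t0 : 0 < t.+1`!%:R :> R by rewrite ltr0n fact_gt0.
have e1 : t.+1%:R ^+ t.+1 <= expR 1 ^+ t.+1 * t.+1`!%:R :> R.
  rewrite -ler_pdivrMr // -expRM_natl mulr1.
  by have := @expR_ge1Dxn R t.+1%:R t (ler0n _ _); lra.
apply: (@le_trans _ _ ('C(n, t.+1)%:R * (expR 1 ^+ t.+1 * t.+1`!%:R))).
  by apply: ler_wpM2l; rewrite ?ler0n.
rewrite exprMn mulrCA ler_wpM2l ?exprn_ge0 ?expR_ge0 // -natrM bin_ffact.
by rewrite -natrX ler_nat ffact_le_expn.
Qed.

(** The half has at least [n / 2] elements and [j <= n / 4], so every factor of the falling
    factorial is at least [n / 4]. *)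
Lemma bin_ge_expn n j : (0 < n)%N -> (4 * j <= n)%N ->
  (n%:R / 4) ^+ j / j`!%:R <= 'C(n - n./2, j)%:R :> R.
Proof.
move=> n0 jn; set N := (n - n./2)%N.
have j0 : 0 < j`!%:R :> R by rewrite ltr0n fact_gt0.
rewrite ler_pdivrMr // -natrM bin_ffact.
apply: (@le_trans _ _ ((N - j)%:R ^+ j)).
  apply: lerXn2r; rewrite ?nnegrE ?divr_ge0 ?ler0n //.
  by rewrite ler_pdivrMr // -natrM ler_nat /N; lia.
by rewrite -natrX ler_nat ffact_ge_expn // /N; lia.
Qed.

Lemma expR_le_1D2x s : 0 <= s <= 2^-1 -> expR s <= 1 + 2 * s.
Proof.
move=> /andP[s0 s1]; have := expR_ge1Dx (- s); rewrite expRN => h.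
have e0 := expR_gt0 s.
have : (1 - s) * expR s <= 1 by rewrite -ler_pdivlMr // mul1r; lra.
by nra.
Qed.

Lemma expRN_le s : 0 <= s <= 1 -> expR (- s) <= 1 - s / 2.
Proof.
move=> /andP[s0 s1]; have h := expR_ge1Dx s; rewrite expRN.
have e0 := expR_gt0 s.
by rewrite -[_^-1]mul1r ler_pdivrMr //; nra.
Qed.

Lemma sum_geometric_le (rho : R) h : 0 <= rho <= 2^-1 ->
  \sum_(1 <= t < h.+1) rho ^+ t <= 2 * rho.
Proof.
move=> /andP[r0 r1].
suff : \sum_(1 <= t < h.+1) rho ^+ t + 2 * rho ^+ h.+1 <= 2 * rho.
  by have := @exprn_ge0 _ h.+1 rho r0; lra.
elim: h => [|h IH]; first by rewrite big_geq // add0r expr1.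
rewrite big_nat_recr //=; have := @exprn_ge0 _ h.+1 rho r0.
by rewrite [rho ^+ h.+2]exprS; nra.
Qed.

Lemma ln_le_linear (A x : R) : 0 < A -> 0 < x -> ln x <= x / A + ln A.
Proof.
move=> A0 x0; rewrite -lerBlDr -ln_div ?posrE //.
by apply: ltW; apply: ln_sublinear; rewrite divr_gt0.
Qed.

Lemma expR_ge_cube x : 0 <= x -> x ^+ 3 <= 27 * expR x.
Proof.
move=> x0; have -> : expR x = expR (x / 3) ^+ 3.
  by rewrite -expRM_natl; congr expR; field.
have h : x / 3 <= expR (x / 3) by have := expR_ge1Dx (x / 3); lra.
have -> : x ^+ 3 = 27 * (x / 3) ^+ 3 by field.
by rewrite ler_pM2l // lerXn2r // nnegrE ?expR_ge0 // divr_ge0.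
Qed.

End Estimates.

(** * Explicit bounds at fixed n *)

Section FixedSize.
Variables (R : realType) (n P K k : nat) (lam alpha : R).
Hypotheses (n_gt1 : (1 < n)%N) (k_gt0 : (0 < k)%N) (KP : (0 < K <= P)%N).
Local Notation L := (ln n%:R : R).
Hypothesis density : K%:R ^+ 2 / P%:R = lam / n%:R.
Hypothesis lamE : lam = L + (k%:R - 1) * ln L + alpha.
Hypothesis lam_half : lam <= n%:R / 2.

Let K_gt0 : (0 < K)%N. Proof. by case/andP: KP. Qed.
Let leKP : (K <= P)%N. Proof. by case/andP: KP. Qed.
Let n0 : 0 < n%:R :> R. Proof. by rewrite ltr0n ltnW. Qed.
Let K0 : 0 < K%:R :> R. Proof. by rewrite ltr0n. Qed.
Let P0 : 0 < P%:R :> R. Proof. by rewrite ltr0n (leq_trans K_gt0). Qed.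
Let L0 : 0 < L. Proof. by rewrite ln_gt0 // ltr1n. Qed.

Let s : R := lam / n%:R.

Let s_gt0 : 0 < s.
Proof. by rewrite /s -density divr_gt0 // exprn_gt0. Qed.

Let s_half : s <= 2^-1.
Proof. by rewrite ler_pdivrMr // mulrC. Qed.

Let lam_gt0 : 0 < lam.
Proof. by have := s_gt0; rewrite /s pmulr_lgt0 // invr_gt0. Qed.

Let ns : n%:R * s = lam.
Proof. by rewrite mulrC divfK // gt_eqF. Qed.

(** The power of [L] comes from the iterated logarithm in [lam]; it will be played against
    [lam ^+ k.-1], which is of the same order. *)
Lemma nodes_mul_expRN : n%:R * expR (- lam) = L ^- k.-1 * expR (- alpha).
Proof.
rewrite lamE !opprD !expRD [expR (- L)]expRN lnK ?posrE // mulrA mulrA mulfV ?gt_eqF //.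
rewrite mul1r; congr (_ * _); rewrite expRN; congr (_^-1).
have -> : k%:R - 1 = k.-1%:R :> R by rewrite -[k in LHS]prednK // -natr1 addrK.
by rewrite expRM_natl lnK ?posrE.
Qed.

Let keep_ratio_ge0 : 0 <= keep_ratio R P K.
Proof. by rewrite subr_ge0 ler_pdivrMr // mul1r ler_nat. Qed.

Lemma keep_ratio_pow_le : keep_ratio R P K ^+ K <= expR (- s).
Proof.
have -> : - s = K%:R * - (K%:R / P%:R) by rewrite /s -density; ring.
rewrite expRM_natl; apply: lerXn2r.
- exact: keep_ratio_ge0.
- by rewrite nnegrE expR_ge0.
- by apply: le_trans (expR_ge1Dx _); rewrite /keep_ratio.
Qed.

(** * Lower bound for the probability of robustness *)

Section OneLaw.
Hypothesis lam_ge1 : 1 <= lam.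
Hypothesis lam_le2L : lam <= 2 * L.
Hypothesis lam_ln : lam / 2 + ln lam <= L.

(** With this choice the correction [2 * y * n * s] in the exponent is the constant 2, while
    Markov's inequality costs only [lam ^+ k.-1]. *)
Let y : R := lam^-1.

Lemma few_crossing_base_le :
  y + (1 - y) * keep_ratio R P K ^+ K <= expR (- s + 2 * y * s).
Proof.
have y1 : y <= 1 by rewrite /y invf_le1.
have y0 : 0 < y by rewrite invr_gt0.
apply: (@le_trans _ _ (y + (1 - y) * expR (- s))).
  by rewrite lerD2l ler_wpM2l ?subr_ge0 // keep_ratio_pow_le.
have -> : y + (1 - y) * expR (- s) = expR (- s) * (1 + y * (expR s - 1)).
  have : expR (- s) * expR s = 1 by rewrite mulrC expRxMexpNx_1.
  move: (expR (- s)) (expR s) => a b ab.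
  have -> : a * (1 + y * (b - 1)) = a + y * (a * b) - y * a by ring.
  by rewrite ab; ring.
rewrite expRD ler_wpM2l ?expR_ge0 //; apply: le_trans (expR_ge1Dx _).
have -> : 2 * y * s = y * (2 * s) by ring.
rewrite lerD2l ler_wpM2l ?(ltW y0) //.
by have := @expR_le_1D2x R s; rewrite ltW // s_half => /(_ isT); lra.
Qed.

(** If [t * lam <= n], the exponent is at most 1. Otherwise it is at most [lam / 2 <= L - ln lam],
    so the exponential is at most [n / lam < t]. The factor [t] will be absorbed by [t ^ t] in the
    binomial bound. *)
Lemma expR_mul_le t : (0 < t)%N -> (t <= n./2)%N -> expR (t%:R * s) <= expR 1 * t%:R.
Proof.
move=> t0 tn.
have t1 : 1 <= t%:R :> R by rewrite ler1n.
have t2n : t%:R * 2 <= n%:R :> R by rewrite -natrM ler_nat leq_half_mul2.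
have e1 : 1 <= expR 1 :> R by have := expR_ge1Dx (1 : R); lra.
have [small|big] := leP (t%:R * lam) n%:R.
  apply: (@le_trans _ _ (expR 1)); last by rewrite ler_peMr // expR_ge0.
  by rewrite ler_expR /s mulrA ler_pdivrMr // mul1r.
apply: (@le_trans _ _ (expR (lam / 2))).
  rewrite ler_expR /s mulrA ler_pdivrMr //.
  by have := lam_gt0; nra.
apply: (@le_trans _ _ (expR (L - ln lam))); first by rewrite ler_expR lerBrDr.
rewrite expRB !lnK ?posrE // ler_pdivrMr // -mulrA.
by apply: (le_trans (ltW big)); rewrite ler_peMl // mulr_ge0 // ltW.
Qed.

Lemma few_crossing_bound_le t : (0 < t)%N -> (t <= n./2)%N ->
  few_crossing_bound P K y k (n - t) <=
  2 * expR 3 * lam ^+ k.-1 * expR (- lam) * t%:R.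
Proof.
move=> t0 tn; have tn' := leq_of_leq_half tn.
have y0 : 0 < y by rewrite invr_gt0.
have y1 : y <= 1 by rewrite /y invf_le1.
rewrite /few_crossing_bound -exprVn invrK.
have base0 : 0 <= y + (1 - y) * keep_ratio R P K ^+ K.
  by rewrite addr_ge0 ?mulr_ge0 ?subr_ge0 ?exprn_ge0 ?(ltW y0).
have h1 : (y + (1 - y) * keep_ratio R P K ^+ K) ^+ (n - t) <=
          expR (- lam) * expR (t%:R * s) * expR 2.
  apply: (@le_trans _ _ (expR (- s + 2 * y * s) ^+ (n - t))).
    by apply: lerXn2r; rewrite ?nnegrE ?expR_ge0 ?few_crossing_base_le.
  rewrite -expRM_natl -!expRD ler_expR natrB //.
  have yts : 0 <= y * (t%:R * s) by rewrite !mulr_ge0 ?ler0n // ltW.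
  have -> : (n%:R - t%:R) * (- s + 2 * y * s) =
      t%:R * s - n%:R * s + 2 * (y * (n%:R * s)) - 2 * (y * (t%:R * s)) by ring.
  have -> : y * (n%:R * s) = 1 by rewrite ns mulVf // gt_eqF.
  by rewrite ns; lra.
have h2 := expR_mul_le t0 tn.
have E3 : expR 3 = expR 1 * expR 2 :> R by rewrite -expRD; congr expR; ring.
have -> : 2 * expR 3 * lam ^+ k.-1 * expR (- lam) * t%:R =
  lam ^+ k.-1 * (2 * (expR (- lam) * (expR 1 * t%:R) * expR 2)) by rewrite E3; ring.
rewrite ler_wpM2l ?exprn_ge0 ?(ltW lam_gt0) // ler_pM2l //.
apply: (le_trans h1); rewrite ler_wpM2r ?expR_ge0 // ler_wpM2l ?expR_ge0 //.
Qed.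

Lemma prob_robust_ge_explicit (rho := 2 ^+ k * expR 4 * expR (- alpha)) :
  rho <= 2^-1 -> 1 - (2 * (lam ^+ 2 / K%:R) + 2 * rho) <= prob_k_robust R n P K k.
Proof.
move=> rho_half.
have y0 : 0 < y by rewrite invr_gt0.
have y01 : 0 < y <= 1 by rewrite y0 /y invf_le1.
(* Strictness follows from [K <= K ^+ 2 = s * P <= P / 2]. *)
have ltKP : (0 < K < P)%N.
  rewrite K_gt0 -(ltr_nat R) /=; have K1 : 1 <= K%:R :> R by rewrite ler1n.
  have KsP : K%:R ^+ 2 = s * P%:R by rewrite /s -density divfK // gt_eqF.
  have KK : K%:R <= K%:R ^+ 2 :> R by rewrite expr2 ler_peMl // ltW.
  have sP : s * P%:R <= 2^-1 * P%:R by rewrite ler_pM2r.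
  by rewrite KsP in KK; have := P0; lra.
have rho0 : 0 <= rho by rewrite !mulr_ge0 ?expR_ge0 ?exprn_ge0.
apply: le_trans (prob_robust_ge n ltKP k_gt0 y01); rewrite lerD2l lerN2.
apply: lerD.
  (* As [s = K ^+ 2 / P], the overlap term is [(n * s) ^+ 2 / K]. *)
  rewrite ler_pM2l // -ns.
  have -> : s = K%:R ^+ 2 / P%:R by rewrite /s density.
  rewrite le_eqVlt; apply/orP; left; apply/eqP; field.
  by rewrite !gt_eqF.
apply: (@le_trans _ _ (\sum_(1 <= t < n./2.+1) rho ^+ t)); last first.
  by apply: sum_geometric_le; rewrite rho0.
apply: ler_sum_nat => t /andP[t0 tn]; rewrite ltnS in tn.
set B := 2 * expR 3 * lam ^+ k.-1 * expR (- lam).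
have B0 : 0 <= B by rewrite !mulr_ge0 ?expR_ge0 ?exprn_ge0 ?(ltW lam_gt0).
have f0 : 0 <= few_crossing_bound P K y k (n - t).
  rewrite /few_crossing_bound mulr_ge0 ?invr_ge0 ?exprn_ge0 ?(ltW y0) //.
  rewrite mulr_ge0 // exprn_ge0 // addr_ge0 ?mulr_ge0 ?subr_ge0 ?exprn_ge0 ?(ltW y0) //.
  by case/andP: y01.
apply: (@le_trans _ _ ('C(n, t)%:R * (B * t%:R) ^+ t)).
  rewrite ler_wpM2l ?ler0n //; apply: lerXn2r; [exact: f0| |].
    by rewrite nnegrE mulr_ge0 ?ler0n.
  exact: few_crossing_bound_le.
(* The factor [t ^+ t] turns the binomial coefficient into [(e n) ^+ t], which makes the sum over
   cut sizes geometric. *)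
rewrite exprMn mulrCA; apply: (@le_trans _ _ (B ^+ t * (expR 1 * n%:R) ^+ t)).
  by rewrite ler_wpM2l ?exprn_ge0 // bin_mul_expn_le.
rewrite -exprMn; apply: lerXn2r; [|exact: rho0|].
  by rewrite nnegrE mulr_ge0 // mulr_ge0 ?expR_ge0 ?ler0n.
have -> : B * (expR 1 * n%:R) = 2 * expR 4 * lam ^+ k.-1 * (n%:R * expR (- lam)).
  rewrite /B (_ : expR 4 = expR 3 * expR 1); first by ring.
  by rewrite -expRD; congr expR; ring.
rewrite nodes_mul_expRN.
(* Together with the factor 2 from the overlap threshold this gives the [2 ^+ k] in [rho]. *)
have : (lam / L) ^+ k.-1 <= 2 ^+ k.-1.
  by apply: lerXn2r; rewrite ?nnegrE ?divr_ge0 ?(ltW lam_gt0) ?(ltW L0) ?ler_pdivrMr.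
rewrite expr_div_n => lL.
have -> : rho = 2 * expR 4 * expR (- alpha) * 2 ^+ k.-1.
  by rewrite /rho -[in LHS](prednK k_gt0) exprS; ring.
rewrite (_ : _ * _ = 2 * expR 4 * expR (- alpha) * (lam ^+ k.-1 / L ^+ k.-1)); last by ring.
by rewrite ler_wpM2l // !mulr_ge0 ?expR_ge0.
Qed.

End OneLaw.

(** * Upper bound for the probability of robustness *)

Section ZeroLaw.
Hypothesis n_large : (4 * k <= n)%N.
Hypothesis lam_geL : L / 2 <= lam.
Hypothesis lam_sq : lam ^+ 2 <= n%:R / 2.

Local Notation q := (avoid_prob R P K K).

(** The edge probability [1 - q] lies between [s / 2] and [s]; this half is the union bound over the
    [K] objects of one node. *)
Let q_ge : 1 - s <= q.
Proof.
have := @avoid_prob_ge_linear R P K _ _ K; rewrite mulrA -expr2 density -/s.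
by apply; case/andP: KP.
Qed.

Let q_le : 1 - q >= s / 2.
Proof.
have /andP[K1 K2] := KP.
have := avoid_prob_le_expn R K2 K1 K; have := keep_ratio_pow_le.
rewrite /keep_ratio; have := @expRN_le R s.
rewrite ltW // => /(_ _); rewrite (le_trans s_half) // => [/(_ isT)|]; last by lra.
by move=> a b c; have := le_trans c (le_trans b a); lra.
Qed.

(** From [1 + s <= expR s], [(1 - s) ^+ n] is at least [(1 - s ^+ 2) ^+ n * expR (- lam)].
    Bernoulli's inequality and [lam ^+ 2 <= n / 2] keep the first factor above one half. *)
Let q_pow : expR (- lam) / 2 <= q ^+ n.
Proof.
apply: (@le_trans _ _ ((1 - s) ^+ n)); last first.
  by apply: lerXn2r; rewrite ?nnegrE ?avoid_prob_ge0 //; have := s_half; lra.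
have h : (1 - s ^+ 2) * expR (- s) <= 1 - s.
  rewrite expRN ler_pdivrMr ?expR_gt0 //; have := expR_ge1Dx s.
  by have := s_half; have := s_gt0; nra.
have s2 : 0 <= s ^+ 2 <= 1 by have := s_half; have := s_gt0; nra.
apply: (@le_trans _ _ ((1 - s ^+ 2) ^+ n * expR (- s) ^+ n)).
  rewrite -expRM_natl mulrN ns mulrC ler_wpM2r ?expR_ge0 //.
  apply: le_trans (bernoulli_ineq n s2).
  have -> : n%:R * s ^+ 2 = lam ^+ 2 / n%:R.
    by rewrite /s; field; rewrite gt_eqF.
  have : lam ^+ 2 / n%:R <= 2^-1 by rewrite ler_pdivrMr // mulrC.
  by lra.
rewrite -exprMn; apply: lerXn2r; rewrite ?nnegrE //.
  by rewrite mulr_ge0 ?expR_ge0 //; have := s_half; have := s_gt0; nra.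
by have := s_half; lra.
Qed.

Lemma prob_robust_le_explicit :
  prob_k_robust R n P K k
  <= 6 * 16 ^+ k.-1 * k.-1`!%:R * expR alpha + 2 * (lam / n%:R).
Proof.
have /andP[K1 K2] := KP.
have q_half : 2^-1 <= q by have := q_ge; have := s_half; lra.
have q1 : q <= 1 by exact: avoid_prob_le1.
have q0 : 0 < q by apply: lt_le_trans q_half.
set j := k.-1.
have f0 : 0 < j`!%:R :> R by rewrite ltr0n fact_gt0.
have [V1 [V1E V1C]] := exists_half_set n.
set m := #|V1|%:R * low_prob R P K k V1.
(* The 6 combines a half of at least [n / 3] nodes with the one half in [q_pow]. The 16 combines
   [n / 4] from the binomial, [s / 2] from the edge probability and [L / 2 <= lam]. *)
have m_ge : (6 * 16 ^+ j * j`!%:R * expR alpha)^-1 <= m.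
  have few_ge : (n%:R / 4) ^+ j / j`!%:R * (s / 2) ^+ j * q ^+ (n - n./2)
                <= few_prob q (n - n./2) k.
    rewrite -[k](prednK k_gt0) -/j; apply: le_trans (few_prob_ge _ _ _); last first.
      by rewrite ltW // q1.
    rewrite ler_wpM2r ?exprn_ge0 ?(ltW q0) //; apply: ler_pM.
    - by rewrite divr_ge0 ?exprn_ge0 ?divr_ge0 ?ler0n.
    - by rewrite exprn_ge0 // divr_ge0 // ltW.
    - apply: bin_ge_expn; first exact: ltnW.
      by apply: leq_trans n_large; rewrite leq_mul2l /= leq_pred.
    - by apply: lerXn2r; rewrite ?nnegrE ?subr_ge0 // divr_ge0 // ltW.
  have qq : q ^+ n <= q ^+ (n./2).-1 * q ^+ (n - n./2).
    by rewrite -exprD; apply: ler_wiXn2l; rewrite ?(ltW q0) ?leq_half_parts.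
  have half_ge : n%:R / 3 <= (n./2)%:R :> R.
    rewrite ler_pdivrMr // -natrM ler_nat leq_half_mul3 //.
    by apply: leq_trans n_large; rewrite (leq_mul2l 4 1).
  pose c := (n%:R / 4) ^+ j / j`!%:R * (s / 2) ^+ j.
  have c0 : 0 <= c.
    by rewrite /c !mulr_ge0 ?exprn_ge0 ?invr_ge0 ?(ltW f0) ?divr_ge0 ?ler0n // ltW.
  apply: (@le_trans _ _ (n%:R / 3 * (c * (expR (- lam) / 2)))); last first.
    rewrite /m /low_prob V1E V1C; apply: ler_pM.
    - by rewrite divr_ge0 ?ler0n.
    - by rewrite mulr_ge0 // divr_ge0 ?expR_ge0.
    - exact: half_ge.
    apply: (@le_trans _ _ (c * (q ^+ (n./2).-1 * q ^+ (n - n./2)))).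
      by rewrite ler_wpM2l // (le_trans q_pow).
    by rewrite mulrCA ler_wpM2l ?exprn_ge0 ?(ltW q0).
  have -> : n%:R / 3 * (c * (expR (- lam) / 2)) =
      (n%:R / 4 * (s / 2)) ^+ j * (n%:R * expR (- lam)) / (6 * j`!%:R).
    rewrite /c (exprMn _ (n%:R / 4) (s / 2)).
    by move: ((n%:R / 4) ^+ j) ((s / 2) ^+ j) => a b; field; rewrite gt_eqF.
  rewrite (_ : n%:R / 4 * (s / 2) = lam / 8); last by rewrite -ns; field.
  rewrite nodes_mul_expRN -/j expRN.
  have e0 := expR_gt0 alpha.
  have lL : 2^-1 ^+ j <= (lam / L) ^+ j.
    apply: lerXn2r; rewrite ?nnegrE ?divr_ge0 ?(ltW lam_gt0) ?(ltW L0) //.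
    by rewrite ler_pdivlMr // mulrC.
  have -> : (lam / 8) ^+ j * (L ^- j / expR alpha) / (6 * j`!%:R) =
     (lam / L) ^+ j * (8 ^+ j * 6 * j`!%:R * expR alpha)^-1.
    by rewrite !expr_div_n; field; rewrite !gt_eqF ?exprn_gt0.
  have -> : (6 * 16 ^+ j * j`!%:R * expR alpha)^-1 =
     2^-1 ^+ j * (8 ^+ j * 6 * j`!%:R * expR alpha)^-1.
    have -> : 16 = 2 * 8 :> R by ring.
    by rewrite exprMn exprVn; field; rewrite !gt_eqF ?exprn_gt0.
  by rewrite ler_wpM2r // invr_ge0 !mulr_ge0 ?exprn_ge0 ?expR_ge0 ?ler0n.
have c_gt0 : 0 < 6 * 16 ^+ j * j`!%:R * expR alpha.
  by rewrite !mulr_gt0 ?expR_gt0 ?exprn_gt0.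
have m0 : 0 < m by apply: lt_le_trans m_ge; rewrite invr_gt0.
apply: (le_trans (prob_robust_le n_gt1 k_gt0 KP q0 m0)); rewrite -/m.
apply: lerD; first by rewrite -[leRHS]invrK lef_pV2 // posrE invr_gt0.
rewrite -/s -lerBrDr opprK -[q^-1]mul1r ler_pdivrMr //.
by have := q_ge; have := s_half; have := s_gt0; nra.
Qed.

End ZeroLaw.
End FixedSize.

(** * Passage to the limit *)

Lemma prob_k_robust_ge0 (R : realFieldType) n P K k :
  0 <= prob_k_robust R n P K k.
Proof.
by rewrite prob_robust_expect; apply: expect_ge0 => [x|S];
  rewrite ?unif_pmf_ge0 ?ler0n.
Qed.

Lemma prob_k_robust_le1 (R : realFieldType) n P K k :
  (K <= P)%N -> prob_k_robust R n P K k <= 1.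
Proof.
move=> leKP; rewrite prob_robust_expect.
rewrite -[leRHS](expect1 'I_n (unif_pmf_sum R leKP)).
by apply: (expect_le (@unif_pmf_ge0 R P K)) => S _; rewrite lern1 leq_b1.
Qed.

Lemma near_ln_ge (R : realType) (A : R) : \forall n \near \oo, A <= ln n%:R.
Proof.
near=> n.
have h : expR A <= n%:R by near: n; exact: nbhs_infty_ger.
rewrite -[A]expRK ler_ln ?posrE ?expR_gt0 //.
exact: lt_le_trans (expR_gt0 _) h.
Unshelve. all: by end_near. Qed.

(** * Size of the mean degree for large [n] *)

Section Regime.
Variables (R : realType) (n k : nat) (alpha : R).
Local Notation L := (ln n%:R : R).
Local Notation lam := (L + (k%:R - 1) * ln L + alpha).
Hypothesis k_gt0 : (0 < k)%N.
Hypothesis L_large : 100 <= L.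
Hypothesis L_large' : 16 * (k%:R * ln (16 * k%:R)) <= L.
Hypothesis alpha_small : `|alpha| <= 8^-1 * L.

Let k1 : 1 <= k%:R :> R. Proof. by rewrite ler1n. Qed.

Lemma regime_lam : 2^-1 * L <= lam <= 5 / 4 * L.
Proof.
have Ll := L_large; have Ll' := L_large'.
have lnL : 0 <= ln L by apply: ln_ge0; lra.
have kR := k1.
(* The slope [1 / (16 k)] and [L_large'] keep the iterated logarithm term below [L / 8], as much as
   is allowed to [alpha]. *)
have lnLk : ln L <= L / (16 * k%:R) + ln (16 * k%:R) by apply: ln_le_linear; lra.
have a : (k%:R - 1) * ln L <= k%:R * (L / (16 * k%:R) + ln (16 * k%:R)).
  by nra.
have b : k%:R * (L / (16 * k%:R)) = L / 16 by field; lra.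
rewrite mulrDr b in a.
have c : 0 <= (k%:R - 1) * ln L by rewrite mulr_ge0 // subr_ge0.
by move: alpha_small; rewrite ler_norml => /andP[]; lra.
Qed.

Lemma nodes_gt0 : 0 < n%:R :> R.
Proof.
rewrite ltr0n lt0n; apply/eqP => n0; move: L_large.
by rewrite n0 ln0 //; lra.
Qed.

Lemma cube_le_nodes : L ^+ 3 <= 27 * n%:R.
Proof.
have Ll := L_large; have := @expR_ge_cube R L; rewrite lnK ?posrE ?nodes_gt0 //; apply; lra.
Qed.

Lemma regime_lam_sq : lam ^+ 2 <= n%:R / 2.
Proof.
have Ll := L_large; have /andP[l1 l2] := regime_lam.
have h := cube_le_nodes.
apply: (@le_trans _ _ ((5 / 4 * L) ^+ 2)); first by apply: lerXn2r; rewrite ?nnegrE; lra.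
(* With [L ^+ 3 <= 27 n] this puts [25 / 16 * L ^+ 2] below [n / 2]. *)
have : 100 * L ^+ 2 <= L ^+ 3 by rewrite [leRHS]exprS ler_wpM2r ?exprn_even_ge0.
have : 0 <= L ^+ 2 by rewrite exprn_even_ge0.
by rewrite exprMn; lra.
Qed.

Lemma regime_lam_half : lam <= n%:R / 2.
Proof.
have Ll := L_large; have /andP[l1 l2] := regime_lam; apply: le_trans regime_lam_sq.
by rewrite expr2 ler_peMr; lra.
Qed.

(** The condition by which [expR_mul_le] handles large [t]; slope [1 / 8] for the logarithm
    suffices. *)
Lemma regime_lam_ln : lam / 2 + ln lam <= L.
Proof.
have Ll := L_large; have /andP[l1 l2] := regime_lam.
have h : ln lam <= lam / 8 + ln 8 by apply: ln_le_linear; lra.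
have h8 : ln 8 < 8 :> R by apply: ln_sublinear.
by lra.
Qed.

Lemma regime_lam_div : lam / n%:R <= 54 / L.
Proof.
have Ll := L_large; have /andP[l1 l2] := regime_lam; have n0 := nodes_gt0; have h := cube_le_nodes.
rewrite ler_pdivrMr // mulrAC ler_pdivlMr; last lra.
apply: (@le_trans _ _ (5 / 4 * L ^+ 2)).
  by rewrite expr2 mulrA ler_wpM2r //; lra.
have : L ^+ 2 <= L ^+ 3 by rewrite [leRHS]exprS ler_peMl ?exprn_even_ge0 //; lra.
by lra.
Qed.

End Regime.

Theorem theorem6 (R : realType) (k : nat) (P K : nat -> nat) (alpha : nat -> R)
  (hk : (0 < k)%N)
  (hKP : forall n : nat, (0 < n)%N -> (1 <= K n <= P n)%N)
  (halpha : forall n : nat, (1 < n)%N ->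
     (K n)%:R ^+ 2 / (P n)%:R
     = (ln n%:R + (k%:R - 1) * ln (ln n%:R) + alpha n) / n%:R)
  (hK : (fun n : nat => (K n)%:R : R^o)
          \is 'Omega_\oo (fun n : nat => (ln n%:R) ^+ 3 : R^o))
  (halpha_o : (fun n : nat => `|alpha n| : R^o)
                =o_\oo (fun n : nat => ln n%:R : R^o)) :
  (alpha n @[n --> \oo] --> -oo ->
     prob_k_robust R n (P n) (K n) k @[n --> \oo] --> (0 : R)) /\
  (alpha n @[n --> \oo] --> +oo ->
     prob_k_robust R n (P n) (K n) k @[n --> \oo] --> (1 : R)).
Proof.
have alpha_small : \forall n \near \oo, `|alpha n| <= 8^-1 * ln n%:R.
  have e8 : (0 : R) < 8^-1 by [].
  move/eqoP : halpha_o => /(_ _ e8) h.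
  near=> n.
  have : `| `|alpha n| | <= 8^-1 * `|ln n%:R| by near: n.
  by rewrite normr_id [`|ln _|]ger0_norm //; near: n; exact: near_ln_ge.
move: hK; rewrite qualifE => /asboolP[c c0 hc].
split => alpha_lim; apply/cvgrPdist_le => e e0; near=> n.
- have L1 : 100 <= ln n%:R :> R by near: n; exact: near_ln_ge.
  have L2 : 16 * (k%:R * ln (16 * k%:R)) <= ln n%:R :> R by near: n; exact: near_ln_ge.
  have al : `|alpha n| <= 8^-1 * ln n%:R by near: n.
  have n4k : (4 * k <= n)%N by near: n; exact: nbhs_infty_ge.
  have n1 : (1 < n)%N by near: n; exact: nbhs_infty_ge.
  (* As 216 is [4 * 54], the term [2 * (lam / n)] is then at most [e / 2]. *)
  have L3 : 216 / e <= ln n%:R by near: n; exact: near_ln_ge.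
  set C : R := 6 * 16 ^+ k.-1 * k.-1`!%:R.
  have C0 : 0 < C by rewrite !mulr_gt0 ?exprn_gt0 ?ltr0n ?fact_gt0.
  have An : alpha n <= ln (e / (2 * C)).
    by near: n; move/cvgrNyPle : alpha_lim; exact.
  have /andP[l1 l2] := regime_lam hk L1 L2 al.
  have KP := hKP n (ltnW n1).
  rewrite sub0r normrN ger0_norm ?prob_k_robust_ge0 //.
  apply: (le_trans (prob_robust_le_explicit n1 hk KP (halpha n n1) erefl
    (regime_lam_half hk L1 L2 al) n4k _ (regime_lam_sq hk L1 L2 al))); first lra.
  have h1 : C * expR (alpha n) <= e / 2.
    have : expR (alpha n) <= e / (2 * C).
      rewrite -[leRHS]lnK ?ler_expR // posrE divr_gt0 // mulr_gt0 //.
    rewrite -(ler_pM2l C0) => /le_trans; apply.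
    by rewrite le_eqVlt; apply/orP; left; apply/eqP; field; rewrite gt_eqF.
  have h2 := regime_lam_div hk L1 L2 al.
  have h3 : 54 / ln n%:R <= e / 4.
    rewrite ler_pdivrMr in L3 => //; rewrite ler_pdivrMr; last lra.
    by lra.
  by rewrite -/C; lra.
- have L1 : 100 <= ln n%:R :> R by near: n; exact: near_ln_ge.
  have L2 : 16 * (k%:R * ln (16 * k%:R)) <= ln n%:R :> R by near: n; exact: near_ln_ge.
  have al : `|alpha n| <= 8^-1 * ln n%:R by near: n.
  have n1 : (1 < n)%N by near: n; exact: nbhs_infty_ge.
  set C : R := 2 ^+ k * expR 4.
  have C0 : 0 < C by rewrite mulr_gt0 ?exprn_gt0 ?expR_gt0.
  have KP := hKP n (ltnW n1).
  have /andP[l1 l2] := regime_lam hk L1 L2 al.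
  have rho_le d : 0 < d -> - ln (d / C) <= alpha n -> C * expR (- alpha n) <= d.
    move=> d0; rewrite lerNl => da.
    have : expR (- alpha n) <= d / C by rewrite -[leRHS]lnK ?ler_expR // posrE divr_gt0.
    by rewrite -(ler_pM2l C0) => /le_trans; apply; rewrite mulrC divfK // gt_eqF.
  (* One half is needed to sum the geometric series, [e / 4] to make its sum small. *)
  have r1 : C * expR (- alpha n) <= 2^-1.
    by apply: rho_le => //; near: n; move/cvgryPge : alpha_lim; exact.
  have r2 : C * expR (- alpha n) <= e / 4.
    by apply: rho_le; [lra|]; near: n; move/cvgryPge : alpha_lim; exact.
  (* The growth of [K] enters here: [lam ^+ 2] is at most [2 * L ^+ 2] and [K] at least
     [c * L ^+ 3], so [L >= 8 / (c * e)] suffices. *)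
  have Kn : (ln n%:R + (k%:R - 1) * ln (ln n%:R) + alpha n) ^+ 2 / (K n)%:R <= e / 4.
    have K0 : 0 < (K n)%:R :> R by rewrite ltr0n; case/andP: KP.
    have Kge : c * ln n%:R ^+ 3 <= (K n)%:R.
      have : c * `|ln n%:R ^+ 3| <= `|(K n)%:R| by near: n.
      by rewrite !ger0_norm ?ler0n ?exprn_ge0 //; lra.
    have L3 : 8 / (c * e) <= ln n%:R by near: n; exact: near_ln_ge.
    rewrite ler_pdivrMr ?mulr_gt0 // in L3.
    rewrite ler_pdivrMr //; apply: (@le_trans _ _ (e / 4 * (c * ln n%:R ^+ 3))).
      apply: (@le_trans _ _ ((5 / 4 * ln n%:R) ^+ 2)).
        by apply: lerXn2r; rewrite ?nnegrE; lra.
      have -> : e / 4 * (c * ln n%:R ^+ 3) = (ln n%:R * (c * e)) / 4 * ln n%:R ^+ 2.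
        by rewrite [_ ^+ 3]exprS; ring.
      by rewrite exprMn ler_wpM2r ?exprn_even_ge0 //; lra.
    by rewrite ler_wpM2l // divr_ge0 // ltW.
  rewrite ger0_norm ?subr_ge0 ?prob_k_robust_le1 //; last by case/andP: KP.
  have lo := prob_robust_ge_explicit n1 hk KP (halpha n n1) erefl
    (regime_lam_half hk L1 L2 al) _ _ (regime_lam_ln hk L1 L2 al) r1.
  by have := lo ltac:(lra) ltac:(lra); rewrite -/C; lra.
Unshelve. all: by end_near. Qed.
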